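(* There exists a countable graph $GR(\mathrm{SD})$ such that for every countable smoothly dense subset $V$ of $C[0,1]$ and every $p\in(0,1)$, a random graph sampled from $\mathrm{LARG}(V,p)$ is almost surely isomorphic to $GR(\mathrm{SD})$.
   Context: $C[0,1]$ is the Banach space of continuous real functions on $[0,1]$ with the sup norm $\|\cdot\|$. For a countable $V\subseteq C[0,1]$ and $p\in(0,1)$, $\mathrm{LARG}(V,p)$ is the random graph with vertex set $V$ in which, for each pair $u\neq v$ with $\|u-v\|<1$, an edge $uv$ is included independently with probability $p$ (pairs with $\|u-v\|\ge 1$ are never adjacent). For $x\in\mathbb R$ let $\langle x\rangle=x-\lfloor x\rfloor$. For $f,g\in C[0,1]$, $\mathsf{cr}(f,g)=\{x\in[0,1]:\langle f(x)\rangle=\langle g(x)\rangle\}$. For finite $A,B\subseteq[0,1]$, $A\sim_\epsilon B$ means $|A|=|B|$ and, listing both in increasing order, the $i$-th element of $A$ is within $\epsilon$ of the $i$-th element of $B$ for all $i$. A set $\mathcal F\subseteq C[0,1]$ is transverse if (i) the sets $\mathsf{cr}(f,g)$ are pairwise disjoint for distinct pairs $\{f,g\}$ of distinct elements of $\mathcal F$; and (ii) for all distinct $f,g\in\mathcal F$, $\mathsf{cr}(f,g)$ is finite, does not contain $0$ or $1$, and no $t\in\mathsf{cr}(f,g)$ is a local extremum of $f-g$. A countable $V\subseteq C[0,1]$ is smoothly dense if: (1) $V$ is dense in $C[0,1]$; (2) $V$ is transverse; (3) every $f\in V$ is Lipschitz; (4) for every finite $\mathcal F\subseteq V$, every $f\in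 C[0,1]$ with $\mathcal F\cup\{f\}$ transverse, and every $\epsilon>0$, there is $g\in V$ with $\|f-g\|<\epsilon$ and $\mathsf{cr}(f,h)\sim_\epsilon\mathsf{cr}(g,h)$ for all $h\in\mathcal F$ (such $g$ is called a smooth $\epsilon$-approximation of $f$ relative to $\mathcal F$). *)

(* Defs.v *)
From HB Require Import structures.
From mathcomp Require Import all_boot all_order all_algebra finmap.
From mathcomp Require Import all_classical all_reals all_analysis.

Set Implicit Arguments.
Unset Strict Implicit.
Unset Printing Implicit Defensive.

Import Order.TTheory GRing.Theory Num.Theory.
Import numFieldNormedType.Exports.

Local Open Scope classical_set_scope.
Local Open Scope ring_scope.

Section FunctionSpace.
Context (R : realType).

Definition unitI : topologicalType := set_type `[0 : R, 1].

Definition C01 : Type := continuousType unitI R.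

Definition supnorm (h : unitI -> R) : R := sup (range (fun x => `|h x|)).

Definition supdist (f g : C01) : R := supnorm (f \- g).

Definition frac_part (x : R) : R := x - (Num.floor x)%:~R.

Definition cr (f g : C01) : set R :=
  [set set_val t | t in [set t : unitI | frac_part (f t) = frac_part (g t)]].

Definition local_extremum (h : unitI -> R) (t : unitI) : Prop :=
  (\forall x \near t, h x <= h t) \/ (\forall x \near t, h t <= h x).

(* [s] and [t] are the increasing enumerations of [A] and [B]; in particular
   the relation fails as soon as [A] or [B] is infinite. *)
Definition sim_eps (eps : R) (A B : set R) : Prop :=
  exists s t : seq R,
    [/\ sorted <%R s, A = [set` s], sorted <%R t & B = [set` t]] /\
    size s = size t /\
    forall i, (i < size s)%N -> `|s`_i - t`_i| <= eps.

Definition transverse (F : set C01) : Prop :=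
  (forall f g f' g' : C01, F f -> F g -> F f' -> F g' ->
     f <> g -> f' <> g' -> [set f; g] <> [set f'; g'] ->
     cr f g `&` cr f' g' = set0) /\
  (forall f g : C01, F f -> F g -> f <> g ->
     [/\ finite_set (cr f g), ~ cr f g 0, ~ cr f g 1 &
         forall t : unitI, cr f g (set_val t) -> ~ local_extremum (f \- g) t]).

Definition is_lipschitz (f : C01) : Prop :=
  exists K : R, forall x y : unitI, `|f x - f y| <= K * `|set_val x - set_val y|.

Definition smooth_approx (eps : R) (F : set C01) (f g : C01) : Prop :=
  supdist f g < eps /\ forall h, F h -> sim_eps eps (cr f h) (cr g h).

(* In the last clause [f] lies outside [F]: for [h = f] the set [cr f h] is the
   whole interval, to which [sim_eps] does not apply. *)
Definition smoothly_dense (V : set C01) : Prop :=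
  [/\ forall (f : C01) (eps : R), 0 < eps -> exists2 g, V g & supdist f g < eps,
      transverse V,
      forall f, V f -> is_lipschitz f &
      forall (F : set C01) (f : C01) (eps : R),
        finite_set F -> F `<=` V -> ~ F f -> transverse (F `|` [set f]) ->
        0 < eps -> exists2 g, V g & smooth_approx eps F f g].

End FunctionSpace.

(* Edges of a simple graph are the unordered pairs [[set x; y]] with x <> y. *)
Record sgraph (T : Type) := SGraph {
  edges : set (set T);
  edges_pair : forall e, edges e -> exists x y : T, x <> y /\ e = [set x; y] }.

Definition adj (T : Type) (G : sgraph T) (x y : T) : Prop := edges G [set x; y].

Definition graph_iso (T U : Type) (G : sgraph T) (H : sgraph U) : Prop :=
  exists2 f : T -> U, bijective f &
    forall x y : T, adj G x y <-> adj H (f x) (f y).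

Definition mutually_independent (R : realType) (d : measure_display)
    (T : measurableType d) (P : probability T R) (I : choiceType) (D : set I)
    (E : I -> set T) : Prop :=
  forall J : {fset I}, [set` J] `<=` D ->
    P (\bigcap_(i in [set` J]) E i) = (\prod_(i <- J) P (E i))%E.

Definition near_pairs (R : realType) (V : set (C01 R)) : set (set (set_type V)) :=
  [set e | exists u v : set_type V,
     [/\ u <> v, supdist (set_val u) (set_val v) < 1 & e = [set u; v]]].
Arguments near_pairs {R} V.

(* The random graph [G], defined on the probability space [P], has law
   LARG(V, p). *)
Definition is_LARG (R : realType) (V : set (C01 R)) (p : R)
    (d : measure_display) (T : measurableType d) (P : probability T R)
    (G : T -> sgraph (set_type V)) : Prop :=
  let E (e : set (set_type V)) : set T := [set w | edges (G w) e] in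
  [/\ forall w, edges (G w) `<=` near_pairs V,
      forall e, near_pairs V e -> measurable (E e),
      forall e, near_pairs V e -> P (E e) = p%:E &
      mutually_independent P (near_pairs V) E].
Arguments is_LARG {R} V p {d T} P G.

(* Main.v *)
Require Import Defs.
From HB Require Import structures.
From mathcomp Require Import all_boot all_order all_algebra finmap.
From mathcomp Require Import all_classical all_reals all_analysis.
From mathcomp Require Import ring lra zify.

Import Order.TTheory GRing.Theory Num.Theory.
Import numFieldNormedType.Exports.

Local Open Scope classical_set_scope.
Local Open Scope ring_scope.

(** The isomorphism is built by back-and-forth. Two matched finite families
    [f_i], [f'_i] are kept in the same type: for some increasing homeomorphism
    [phi] of the unit interval, [f_i - f_j] at [x] and [f'_i - f'_j] at [phi x]
    have the same integer part for all [i], [j], [x]. The type determines which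
    pairs are at distance less than 1, and also transversality.

    To match a new function [u], the values that a continuous [f'] may take at
    [phi x] form a nonempty interval depending on [x]. These intervals have local
    continuous selections, which are glued by convex combinations along the unit
    interval. The family extended by [f'] is transverse, so [f'] has smooth
    approximations in the target set; when they are fine enough, moving the
    finitely many crossings to their new positions is an increasing
    homeomorphism, so they have the same type as [f']. As [f' 0] can be varied,
    infinitely many vertices have this type. The adjacency patterns of distinct
    such vertices over the finite family are independent with the same positive
    probability, so almost surely one of them has the required pattern. *)

(** * Increasing bijections of the line *)

Section OrderIso.
Context (R : realType).
Implicit Types (phi psi : R -> R).

Definition order_iso phi psi : Prop :=
  [/\ cancel phi psi, cancel psi phi & {mono phi : x y / x <= y}].

Lemma order_iso_id : order_iso id id.
Proof. by split. Qed.

Lemma order_iso_sym phi psi : order_iso phi psi -> order_iso psi phi.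
Proof. by case=> K K' m; split=> // x y; rewrite -m !K'. Qed.

Lemma order_iso_comp phi psi phi' psi' : order_iso phi psi ->
  order_iso phi' psi' -> order_iso (phi' \o phi) (psi \o psi').
Proof.
case=> K K' m [L L' m']; split=> [x|x|x y] /=; rewrite ?L ?K ?K' ?L' //.
by rewrite m' m.
Qed.

Lemma order_iso_lt phi psi : order_iso phi psi -> {mono phi : x y / x < y}.
Proof. by case=> _ _ m x y; rewrite !ltNge m. Qed.

Lemma order_iso_affine (a a' k : R) : 0 < k ->
  order_iso (fun x => a' + k * (x - a)) (fun y => a + k^-1 * (y - a')).
Proof.
move=> k0; have kn0 : k != 0 by rewrite gt_eqF.
split=> [x|x|x y] /=; first by field.
- by field.
- by rewrite lerD2l ler_pM2l// lerD2r.
Qed.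

Lemma order_iso_glue (phi1 psi1 phi2 psi2 : R -> R) (b : R) :
  order_iso phi1 psi1 -> order_iso phi2 psi2 -> phi1 b = phi2 b ->
  order_iso (fun x => if x <= b then phi1 x else phi2 x)
            (fun y => if y <= phi1 b then psi1 y else psi2 y).
Proof.
move=> i1 i2 e; have l1 := order_iso_lt _ _ i1; have l2 := order_iso_lt _ _ i2.
case: i1 i2 => K1 K1' m1 [K2 K2' m2]; split=> [x|y|x y] /=.
- case: (leP x b) => xb; first by rewrite m1 xb K1.
  by rewrite e m2 leNgt xb /= K2.
- case: (leP y (phi1 b)) => yb; first by rewrite -m1 K1' yb.
  by rewrite -m2 K2' -e leNgt yb.
- case: (leP x b) => xb; case: (leP y b) => yb; rewrite ?m1 ?m2 //.
  + rewrite (le_trans xb (ltW yb)); apply: (@le_trans _ _ (phi1 b)).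
      by rewrite m1.
    by rewrite e m2 ltW.
  + rewrite !leNgt (le_lt_trans yb xb) /=; apply/negbTE; rewrite negbK.
    apply: (@le_lt_trans _ _ (phi1 b)); first by rewrite m1.
    by rewrite e l2.
Qed.

Lemma order_iso_continuous phi psi : order_iso phi psi -> continuous phi.
Proof.
move=> i x; have l := order_iso_lt _ _ i; case: (i) => K K' m.
apply/cvgrPdist_lt => e e0.
have : \forall t \near x, t \in `]psi (phi x - e), psi (phi x + e)[.
  apply: near_in_itvoo; rewrite in_itv /= -(l _ x) -(l x) !K'.
  by apply/andP; split; lra.
apply: filterS => t; rewrite in_itv /= -(l _ t) -(l t) !K' => /andP[h1 h2].
rewrite ltr_norml; apply/andP; split; lra.
Qed.

(** Piecewise linear interpolation: an affine piece through the first two points is glued, at the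
    second one, to the map obtained for the rest of the list. *)
Lemma order_iso_sorted (s : seq (R * R)) :
  sorted (fun p q => (p.1 < q.1) && (p.2 < q.2)) s ->
  exists phi psi, order_iso phi psi /\ {in s, forall p, phi p.1 = p.2}.
Proof.
elim: s => [|[a a'] [|[b b'] s] IH] /=.
- by move=> _; exists id, id; split; [exact: order_iso_id|].
- move=> _; exists (fun x => a' + 1 * (x - a)), (fun y => a + 1^-1 * (y - a')).
  split; first exact: order_iso_affine.
  by move=> p; rewrite inE => /eqP -> /=; rewrite subrr mulr0 addr0.
- move=> /andP[/andP[/= ab ab'] sb].
  have [phi [psi [i e]]] := IH sb.
  have e1 : phi b = b' by apply: (e (b, b')); rewrite inE eqxx.
  pose k := (b' - a') / (b - a).
  have k0 : 0 < k by rewrite divr_gt0 // subr_gt0.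
  have kb : a' + k * (b - a) = b'.
    by rewrite /k; field; rewrite subr_eq0 gt_eqF.
  have ii := order_iso_glue _ _ _ _ b (order_iso_affine a a' k k0) i.
  rewrite kb e1 in ii.
  exists (fun x => if x <= b then a' + k * (x - a) else phi x).
  exists (fun y => if y <= b' then a + k^-1 * (y - a') else psi y).
  split; first exact: ii.
  move=> p; rewrite inE => /orP[/eqP -> /=|].
    by rewrite ltW // subrr mulr0 addr0.
  rewrite inE => /orP[/eqP -> /=|ps]; first by rewrite lexx.
  have bp : b < p.1.
    have tr : transitive (fun p q : R * R => (p.1 < q.1) && (p.2 < q.2)).
      move=> y x z /andP[h1 h2] /andP[h3 h4].
      by rewrite (lt_trans h1 h3) (lt_trans h2 h4).
    by have /allP /(_ _ ps) /andP[] := order_path_min tr sb.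
  by rewrite leNgt bp /= e // inE ps orbT.
Qed.

Lemma order_iso_through (P : set (R * R)) : finite_set P ->
  (forall p q, P p -> P q -> p.1 < q.1 -> p.2 < q.2) ->
  (forall p q, P p -> P q -> p.1 = q.1 -> p.2 = q.2) ->
  exists phi psi, order_iso phi psi /\ forall p, P p -> phi p.1 = p.2.
Proof.
move=> /finite_seqP[s0 ->] hlt heq.
pose s := sort (fun p q : R * R => p.1 <= q.1) (undup s0).
have ms p : (p \in s) = (p \in s0) by rewrite mem_sort mem_undup.
have us : uniq s by rewrite sort_uniq undup_uniq.
have ss : sorted (fun p q : R * R => p.1 <= q.1) s.
  by apply: sort_sorted => p q; exact: le_total.
have [|phi [psi [i e]]] := @order_iso_sorted s; last first.
  by exists phi, psi; split => // p ps; apply: e; rewrite ms.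
rewrite sorted_pairwise; last first.
  move=> y x z /andP[h1 h2] /andP[h3 h4].
  by rewrite (lt_trans h1 h3) (lt_trans h2 h4).
apply/(pairwiseP (0, 0)) => i j /[!inE] si sj ij.
set p := nth _ s i; set q := nth _ s j.
have ps : [set` s0] p by rewrite /= -ms mem_nth.
have qs : [set` s0] q by rewrite /= -ms mem_nth.
have pq : p.1 <= q.1.
  move: ss; rewrite sorted_pairwise; last by move=> y x z; exact: le_trans.
  by move/(pairwiseP (0, 0)) => /(_ i j) /[!inE]; exact.
have lpq : p.1 < q.1.
  rewrite lt_neqAle pq andbT; apply/eqP => e1.
  have e2 := heq _ _ ps qs e1.
  have : p = q by move: e1 e2; case: p {ps pq} => ? ?; case: q {qs} => ? ? /= -> ->.
  move/eqP; rewrite nth_uniq // => /eqP e3.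
  by rewrite e3 ltnn in ij.
by rewrite lpq /=; exact: hlt.
Qed.

End OrderIso.

(** * Continuous selections *)

Section RealFunctions.
Context (R : realType).

(** If the floors differed, the larger of them would be an integer between [h x] and [h y], and the
    intermediate value theorem would give a point of the gap where [h] is an integer. *)
Lemma floor_constant_gap (h : R -> R) (a b x y : R) : continuous h ->
  (forall z, a < z < b -> h z \isn't a Num.int) ->
  a < x < b -> a < y < b -> Num.floor (h x) = Num.floor (h y).
Proof.
move=> ch nint; wlog xy : x y / x <= y.
  move=> W hx hy; case: (leP x y) => [xy|/ltW yx]; first exact: W.
  by symmetry; apply: W.
move=> /andP[ax xb] /andP[ay yb].
have key k : Num.min (h x) (h y) <= k%:~R <= Num.max (h x) (h y) -> False.
  move=> hk; have [|c] := IVT xy _ hk; first exact: continuous_subspaceT.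
  rewrite in_itv /= => /andP[xc cy] hc.
  have := nint c; rewrite (lt_le_trans ax xc) (le_lt_trans cy yb) => /(_ isT).
  by rewrite hc intr_int.
apply/eqP; rewrite eq_le; apply/andP; split; rewrite leNgt; apply/negP => lt.
- apply: (key (Num.floor (h x))); rewrite le_max floor_le /= andbT ge_min.
  by apply/orP; right; move: lt; rewrite floor_lt_int => /ltW.
- apply: (key (Num.floor (h y))); rewrite le_max floor_le orbT andbT ge_min.
  by apply/orP; left; move: lt; rewrite floor_lt_int => /ltW.
Qed.

(** Finds the open interval of values that satisfy finitely many strict lower and upper bounds.
    Either list may be empty, so the ends are built by induction. *)
Lemma separate_lists (s t : seq R) :
  (forall x y, x \in s -> y \in t -> x < y) ->
  exists lo hi, [/\ lo < hi, forall x, x \in s -> x <= lo &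
                             forall y, y \in t -> hi <= y].
Proof.
elim: s t => [|a s IH] t st.
  elim: t {st} => [|b t [lo [hi [lh _ ht]]]].
    by exists 0, 1; split.
  exists (Num.min b hi - 1), (Num.min b hi); split=> //.
    by rewrite gtrBl.
  move=> y; rewrite inE => /orP[/eqP ->|yt]; rewrite ge_min ?lexx //.
  by rewrite ht // orbT.
have [|lo [hi [lh hs ht]]] := IH t.
  by move=> x y xs yt; apply: st; rewrite ?inE ?xs ?orbT.
have [lah|hla] := ltP (Num.max a lo) hi.
  exists (Num.max a lo), hi; split=> // x; rewrite inE => /orP[/eqP ->|xs].
    by rewrite le_max lexx.
  by rewrite le_max hs // orbT.
have ah : hi <= a by move: hla; rewrite le_max (leNgt hi lo) lh orbF.
suff [hi' [ah' ht']] : exists hi', a < hi' /\ forall y, y \in t -> hi' <= y.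
  exists a, hi'; split=> // x; rewrite inE => /orP[/eqP ->|xs] //.
  by apply: le_trans (hs _ xs) _; apply: le_trans (ltW lh) ah.
have : forall y, y \in t -> a < y by move=> y yt; apply: st => //; rewrite inE eqxx.
elim: t {st ht} => [|b t IHt] at_; first by exists (a + 1); split=> //; rewrite ltrDl.
have [|hi' [h1 h2]] := IHt; first by move=> y yt; apply: at_; rewrite inE yt orbT.
exists (Num.min b hi'); split; first by rewrite lt_min h1 at_ // inE eqxx.
move=> y; rewrite inE => /orP[/eqP ->|yt]; first by rewrite ge_min lexx.
by rewrite ge_min h2 // orbT.
Qed.

(** For [c < d] this rises linearly from 0 to 1 between [c] and [d]. It serves as a blending weight,
    and with ends 0 and 1 as the retraction of the line onto the unit interval. *)
Definition ramp (c d x : R) : R := Num.max 0 (Num.min 1 ((x - c) / (d - c))).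

Lemma ramp_continuous c d : continuous (ramp c d).
Proof.
move=> x.
pose l (z : R) := (z - c) / (d - c).
apply: (@continuous_max R R (cst 0) (cst 1 \min l) x); first exact: cvg_cst.
apply: (@continuous_min R R (cst 1) l x); first exact: cvg_cst.
by apply: cvgM; [apply: cvgB; [exact: cvg_id|exact: cvg_cst]|exact: cvg_cst].
Qed.

Lemma ramp_ge0 c d x : 0 <= ramp c d x.
Proof. by rewrite /ramp le_max lexx. Qed.

Lemma ramp_le1 c d x : ramp c d x <= 1.
Proof. by rewrite /ramp ge_max ler01 ge_min lexx. Qed.

Lemma ramp_eq0 c d x : c < d -> x <= c -> ramp c d x = 0.
Proof.
move=> cd xc; rewrite /ramp; apply/max_idPl; rewrite ge_min; apply/orP; right.
by rewrite pmulr_lle0 ?invr_gt0; lra.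
Qed.

Lemma ramp_eq1 c d x : c < d -> d <= x -> ramp c d x = 1.
Proof.
move=> cd xd; rewrite /ramp (_ : Num.min _ _ = 1); first by apply/max_idPr.
by apply/min_idPl; rewrite ler_pdivlMr; lra.
Qed.

(** Let [T] be the supremum of the [t] up to which a selection exists. A local selection at [T],
    blended with one that reaches close enough to [T], goes beyond [T], so the end of the interval
    is reached. *)
Lemma convex_selection (S : R -> set R) (z0 : R) :
  (forall x y z t, S x y -> S x z -> 0 <= t -> t <= 1 ->
     S x ((1 - t) * y + t * z)) ->
  (\forall x \near (0 : R), S x z0) ->
  (forall x0 : R, 0 <= x0 <= 1 -> exists h : R -> R,
     continuous h /\ \forall x \near x0, S x (h x)) ->
  exists h : R -> R,
    [/\ continuous h, h 0 = z0 & forall x, 0 <= x <= 1 -> S x (h x)].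
Proof.
move=> cvx S0 loc.
pose good t := exists h : R -> R,
  [/\ continuous h, h 0 = z0 & forall x, 0 <= x <= t -> S x (h x)].
suff : good 1 by [].
have good_le t t' : t' <= t -> good t -> good t'.
  move=> tt' [h [ch h0 hS]]; exists h; split=> // x /andP[x0 xt].
  by apply: hS; rewrite x0 (le_trans xt tt').
have [d0 d0pos gd0] : exists2 d0 : R, 0 < d0 & good d0.
  move: S0 => /nbhs_ballP[d /= d_gt0 hd]; exists (d / 2); first by lra.
  exists (cst z0); split => // [x|x /andP[x0 xd]]; first exact: cvg_cst.
  by apply: hd; rewrite /ball /= sub0r normrN ger0_norm; lra.
pose A := [set t | 0 <= t <= 1 /\ good t].
have A0 : A (Num.min d0 1).
  split; last by apply: good_le gd0; rewrite ge_min lexx.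
  by rewrite le_min ler01 ltW //= ge_min lexx orbT.
have supA : has_sup A.
  by split; [exists (Num.min d0 1) | exists 1 => t [/andP[]]].
pose T := sup A.
have T01 : 0 < T <= 1.
  apply/andP; split; last by apply: ge_sup => [|t [/andP[]]//]; exists (Num.min d0 1).
  apply: (@lt_le_trans _ _ (Num.min d0 1)); first by rewrite lt_min d0pos ltr01.
  by apply: ub_le_sup => //; case: supA.
have [|g [cg gS]] := loc T; first by case/andP: T01 => /ltW -> ->.
move: gS => /nbhs_ballP[d /= d_gt0 hd].
have hS x : T - d < x < T + d -> S x (g x).
  move=> /andP[h1 h2]; apply: hd; rewrite /ball /= ltr_norml; apply/andP; split; lra.
have [t [[/andP[t0 t1] [h [ch h0 hSt]]] tT]] : exists t, A t /\ Num.max (T - d) 0 < t.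
  have [||t At ht] := @sup_adherent _ A (Num.min d T).
  - by rewrite lt_min d_gt0; case/andP: T01.
  - by [].
  exists t; split=> //; move: ht; rewrite -/T gt_max => ht.
  have h1 : Num.min d T <= d by rewrite ge_min lexx.
  have h2 : Num.min d T <= T by rewrite ge_min lexx orbT.
  by apply/andP; split; lra.
(* The blending takes place between [c] and [t], where both selections are valid; [0 < c] preserves
   the value [z0] at 0. *)
pose c := (Num.max (T - d) 0 + t) / 2.
have ct : c < t by rewrite /c; lra.
have c0 : Num.max (T - d) 0 < c by rewrite /c; lra.
move: c0; rewrite gt_max => /andP[cTd c0].
have tleT : t <= T.
  by apply: ub_le_sup; [case: supA|split; [rewrite t0 t1|exists h; split]].
have gext : good (T + d / 2).
  pose w := ramp c t.
  exists (fun x => (1 - w x) * h x + w x * g x); split.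
  - move=> x; apply: cvgD; apply: cvgM; [|exact: ch| |exact: cg].
      by apply: cvgB; [exact: cvg_cst|exact: ramp_continuous].
    exact: ramp_continuous.
  - by rewrite /w ramp_eq0 // ?ltW // subr0 mul1r mul0r addr0.
  - move=> x /andP[x0 xT]; have [xc|cx] := leP x c.
      rewrite /w ramp_eq0 // subr0 mul1r mul0r addr0; apply: hSt.
      by rewrite x0; lra.
    have [tx|xt] := leP t x.
      rewrite /w ramp_eq1 // subrr mul0r mul1r add0r; apply: hS; apply/andP; split; lra.
    apply: cvx; [| |exact: ramp_ge0|exact: ramp_le1].
      by apply: hSt; rewrite x0 ltW.
    by apply: hS; apply/andP; split; lra.
apply: (good_le _ _ _ gext); rewrite leNgt; apply/negP => Td1.
have : A (T + d / 2).
  split; first by apply/andP; split; lra.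
  by apply: good_le gext; rewrite lexx.
move=> /(ub_le_sup (proj2 supA)); rewrite -/T; lra.
Qed.

End RealFunctions.

(** * Types of finite families *)

Section UnitInterval.
Context (R : realType).
Implicit Types (f g h : C01 R) (x : R).

Lemma ramp01_id x : 0 <= x <= 1 -> ramp R 0 1 x = x.
Proof.
move=> /andP[x0 x1]; rewrite /ramp !subr0 divr1.
by rewrite (min_idPr x1) (max_idPr x0).
Qed.

Lemma ramp01_mem x : ramp R 0 1 x \in (`[0, 1]%classic : set R).
Proof. by rewrite inE /= in_itv /= ramp_ge0 ramp_le1. Qed.

Definition clampI x : unitI R := exist _ (ramp R 0 1 x) (ramp01_mem x).

Lemma val_clampI x : set_val (clampI x) = ramp R 0 1 x.
Proof. by rewrite set_valE. Qed.

Lemma unitI_itv (t : unitI R) : 0 <= (set_val t : R) <= 1.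
Proof.
have : (set_val t : R) \in (`[0, 1]%classic : set R) by rewrite set_valE; exact: valP.
by rewrite inE /= in_itv.
Qed.

Lemma set_valK (t : unitI R) : clampI (set_val t) = t.
Proof. by apply: val_inj => /=; rewrite ramp01_id ?unitI_itv. Qed.

Lemma clampI_continuous : continuous clampI.
Proof.
move=> x A /= [_ [[B Bop <-] Bfs sBfA]].
have nB : nbhs (ramp R 0 1 x) B by rewrite nbhsE; exists B.
have nA : nbhs x (ramp R 0 1 @^-1` B) := ramp_continuous R 0 1 x B nB.
suff : nbhs x (clampI @^-1` A) by [].
by apply: filterS nA => z Bz; apply: sBfA.
Qed.

Lemma set_val_continuous : continuous (set_val : unitI R -> R).
Proof. exact: (@initial_continuous (unitI R) R set_val). Qed.

Lemma near_clampI (t : unitI R) (P : set (unitI R)) :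
  (\forall s \near t, P s) <-> (\forall x \near (set_val t : R), P (clampI x)).
Proof.
split=> [Pt|Pt].
  by move: (clampI_continuous (set_val t) P); rewrite set_valK => /(_ Pt).
have nS : nbhs t (set_val @^-1` (P \o clampI)) := set_val_continuous t _ Pt.
by apply: filterS nS => s /=; rewrite set_valK.
Qed.

(* Constant continuation of [f] outside the unit interval. *)
Definition ext f x : R := f (clampI x).

Lemma ext_val f (t : unitI R) : ext f (set_val t) = f t.
Proof. by rewrite /ext set_valK. Qed.

Lemma ext_continuous f : continuous (ext f).
Proof.
move=> x; apply: (@continuous_comp _ _ _ clampI f).
  exact: clampI_continuous.
exact: cts_fun.
Qed.

Lemma extB_continuous f g : continuous (fun x => ext f x - ext g x).
Proof. by move=> x; apply: cvgB; apply: ext_continuous. Qed.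

Lemma ext_ramp f x : ext f (ramp R 0 1 x) = ext f x.
Proof. by rewrite -val_clampI ext_val. Qed.

Lemma ext_inj f g : (forall x, ext f x = ext g x) -> f = g.
Proof.
move=> e; apply/continuousEP => t; have := e (set_val t).
by rewrite !ext_val.
Qed.

Lemma C01_of_continuous (k : R -> R) : continuous k ->
  exists f, forall x, 0 <= x <= 1 -> ext f x = k x.
Proof.
move=> ck.
have c : continuous (k \o (set_val : unitI R -> R)).
  by move=> t; apply: continuous_comp; [exact: set_val_continuous|exact: ck].
exists (mkcts c : C01 R) => x x01.
by change (k (set_val (clampI x)) = k x); rewrite val_clampI ramp01_id.
Qed.

Lemma frac_part_eq (a b : R) : frac_part a = frac_part b <-> a - b \is a Num.int.
Proof.
rewrite /frac_part; split=> [e|/intrP[k e]].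
  have -> : a - b = (Num.floor a - Num.floor b)%:~R by rewrite intrB; lra.
  exact: intr_int.
have -> : a = b + k%:~R by rewrite -e; lra.
by rewrite floorDrz ?intr_int // intrKfloor intrD; lra.
Qed.

Lemma crP f g x :
  cr f g x <-> 0 <= x <= 1 /\ ext f x - ext g x \is a Num.int.
Proof.
split=> [[t /= /frac_part_eq h <-]|[x01 h]].
  by rewrite unitI_itv !ext_val.
by exists (clampI x); [exact/frac_part_eq|rewrite val_clampI ramp01_id].
Qed.

Lemma crC f g : cr f g = cr g f.
Proof.
by apply/seteqP; split=> x /crP[x01 h]; apply/crP; split=> //;
  rewrite -opprB rpredN.
Qed.

(** The supremum is attained by compactness, so a strict bound on the distance amounts to a strict
    bound at every point. *)
Lemma supdist_has_max f g : exists2 c, forall x, `|ext f x - ext g x| <= `|ext f c - ext g c|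
  & supdist f g = `|ext f c - ext g c|.
Proof.
have [||c] := @EVT_max R (fun x => `|ext f x - ext g x|) 0 1.
- by [].
- apply: continuous_subspaceT => x; apply: cvg_norm; exact: extB_continuous.
rewrite in_itv /= => c01 maxc; exists c => [x|].
  have := maxc (ramp R 0 1 x); rewrite in_itv /= ramp_ge0 ramp_le1 !ext_ramp.
  exact.
have ubc : ubound (range (fun t => `|(f \- g) t|)) (`|ext f c - ext g c|).
  move=> _ [t _ <-] /=; rewrite -!(ext_val _ t); apply: maxc.
  by rewrite in_itv /= unitI_itv.
have inc : range (fun t => `|(f \- g) t|) (`|ext f c - ext g c|).
  by exists (clampI c).
rewrite /supdist /supnorm; apply/eqP; rewrite eq_le; apply/andP; split.
  by apply: ge_sup => //; eexists; exact: inc.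
by apply: ub_le_sup => //; eexists; exact: ubc.
Qed.

Lemma supdist_ltP f g (e : R) :
  supdist f g < e <-> forall x, `|ext f x - ext g x| < e.
Proof.
have [c cmax ->] := supdist_has_max f g.
by split=> [h x|]; [apply: le_lt_trans h | apply].
Qed.

End UnitInterval.
Arguments ext {R}.

(** * Matched families of the same type *)

Section TypeEquivalence.
Context (R : realType).
Local Notation C := (C01 R).
Implicit Types (m : set (C * C)).

(* Two families have the same type when, after a common reparametrisation of the
   unit interval, all differences have the same integer parts. As [p] and [q] can
   be exchanged, this also matches the points where a difference is an integer. *)
Definition same_floors (phi : R -> R) m : Prop :=
  forall p q, m p -> m q -> forall x,
    Num.floor (ext p.1 x - ext q.1 x) =
    Num.floor (ext p.2 (phi x) - ext q.2 (phi x)).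

(** A total map of the line that fixes 0 and 1 encodes a homeomorphism of the unit interval without
    subtypes. *)
Definition homeo01 (phi psi : R -> R) : Prop :=
  [/\ order_iso R phi psi, phi 0 = 0 & phi 1 = 1].

(** A matching is an arbitrary set of pairs; that it is one-to-one follows from the equality of
    floors, see [equivalent_inj]. *)
Definition equivalent m : Prop :=
  exists phi psi, homeo01 phi psi /\ same_floors phi m.

Lemma homeo01_sym phi psi : homeo01 phi psi -> homeo01 psi phi.
Proof.
case=> i e0 e1; split; first exact: order_iso_sym.
  by case: i => K _ _; rewrite -e0 K.
by case: i => K _ _; rewrite -e1 K.
Qed.

Lemma homeo01_comp phi psi phi' psi' : homeo01 phi psi -> homeo01 phi' psi' ->
  homeo01 (phi' \o phi) (psi \o psi').
Proof.
case=> i e0 e1 [i' e0' e1']; split; first exact: order_iso_comp.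
- by rewrite /= e0.
- by rewrite /= e1.
Qed.

Lemma homeo01_itv phi psi x : homeo01 phi psi -> (0 <= phi x <= 1) = (0 <= x <= 1).
Proof. by case=> [[_ _ m] e0 e1]; rewrite -{1}e0 -{1}e1 !m. Qed.

Lemma ext_homeo01 phi psi (f : C) x : homeo01 phi psi ->
  ext f (phi (ramp R 0 1 x)) = ext f (phi x).
Proof.
case=> [[_ _ m] e0 e1]; rewrite -(ext_ramp _ _ (phi x)); congr (ext f _).
have [x0|x0] := leP x 0.
  rewrite (ramp_eq0 _ 0 1 x) // e0 ramp_eq0 //; last by rewrite -e0 m.
have [x1|x1] := leP 1 x.
  rewrite (ramp_eq1 _ 0 1 x) // e1 ramp_eq1 //; last by rewrite -e1 m.
rewrite [ramp _ _ _ x]ramp01_id ?ramp01_id //.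
- by rewrite -{1}e0 -{1}e1 !m !ltW.
- by rewrite !ltW.
Qed.

Lemma same_floors_unit phi psi m : homeo01 phi psi ->
  (forall p q, m p -> m q -> forall x, 0 <= x <= 1 ->
    Num.floor (ext p.1 x - ext q.1 x) =
    Num.floor (ext p.2 (phi x) - ext q.2 (phi x))) -> same_floors phi m.
Proof.
move=> hphi h p q mp mq x; have := h p q mp mq (ramp R 0 1 x).
rewrite ramp_ge0 ramp_le1 => /(_ isT).
by rewrite !ext_ramp !(ext_homeo01 _ _ _ _ hphi).
Qed.

Lemma equivalent_sub m m' : m `<=` m' -> equivalent m' -> equivalent m.
Proof.
move=> s [phi [psi [h e]]]; exists phi, psi; split=> // p q mp mq.
by apply: e; apply: s.
Qed.

Lemma equivalent_diag (F : set C) : equivalent [set p | F p.1 /\ p.1 = p.2].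
Proof.
exists id, id; split; first by split=> //; exact: order_iso_id.
by move=> p q [_ ep] [_ eq] x; rewrite ep eq.
Qed.

Lemma equivalent_sym m : equivalent m -> equivalent [set p | m (p.2, p.1)].
Proof.
move=> [phi [psi [h e]]]; exists psi, phi; split; first exact: homeo01_sym.
move=> p q mp mq x; have := e _ _ mp mq (psi x) => /= ->.
by case: h => [[_ K _]] _ _; rewrite K.
Qed.

Lemma equivalent_comp m m' m'' : equivalent m -> equivalent m' ->
  (forall p, m'' p -> exists b, m (p.1, b) /\ m' (b, p.2)) -> equivalent m''.
Proof.
move=> [phi [psi [h e]]] [phi' [psi' [h' e']]] c.
exists (phi' \o phi), (psi \o psi'); split; first exact: homeo01_comp.
move=> p q /c[b [pb bp]] /c[d [qd dq]] x.
by rewrite (e _ _ pb qd x) (e' _ _ bp dq (phi x)).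
Qed.

(** For [p.1 = q.1] both differences have floor 0, so [p.2 - q.2] and [q.2 - p.2] are nonnegative
    everywhere. *)
Lemma equivalent_inj m p q : equivalent m -> m p -> m q ->
  p.1 = q.1 <-> p.2 = q.2.
Proof.
suff H m' p' q' : equivalent m' -> m' p' -> m' q' -> p'.1 = q'.1 -> p'.2 = q'.2.
  move=> e mp mq; split; first exact: H e mp mq.
  by apply: (H _ (p.2, p.1) (q.2, q.1) (equivalent_sym _ e)) => /=;
    rewrite -?surjective_pairing.
move=> [phi [psi [[[_ K _] _ _] e]]] mp mq e1; apply: ext_inj => x.
have := e _ _ mp mq (psi x); have := e _ _ mq mp (psi x).
rewrite e1 K subrr floor0 => /esym/eqP; rewrite floor_eq => /andP[h1 _].
by move=> /esym/eqP; rewrite floor_eq => /andP[h2 _]; lra.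
Qed.

(** Distance less than 1 means that the differences in both orders have floor at most 0
    everywhere. *)
Lemma equivalent_near m p q : equivalent m -> m p -> m q ->
  supdist p.1 q.1 < 1 <-> supdist p.2 q.2 < 1.
Proof.
suff H m' p' q' : equivalent m' -> m' p' -> m' q' ->
    supdist p'.1 q'.1 < 1 -> supdist p'.2 q'.2 < 1.
  move=> e mp mq; split; first exact: H e mp mq.
  by apply: (H _ (p.2, p.1) (q.2, q.1) (equivalent_sym _ e)) => /=;
    rewrite -?surjective_pairing.
move=> [phi [psi [[[_ K _] _ _] e]]] mp mq /supdist_ltP h; apply/supdist_ltP => x.
have := e _ _ mp mq (psi x); have := e _ _ mq mp (psi x).
have := h (psi x); rewrite K ltr_norml => /andP[h1 h2] e1 e2.
have : (Num.floor (ext p'.2 x - ext q'.2 x) < 1)%R by rewrite -e2 floor_lt_int.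
have : (Num.floor (ext q'.2 x - ext p'.2 x) < 1)%R by rewrite -e1 floor_lt_int; lra.
by rewrite !floor_lt_int ltr_norml => ? ?; apply/andP; split; lra.
Qed.

(** The two floors add up to 0 at integers and to -1 elsewhere, so the floors of a difference taken
    in both orders reveal whether it is an integer. *)
Lemma int_floorN (d : R) : (d \is a Num.int) = (Num.floor d + Num.floor (- d) == 0).
Proof.
apply/idP/eqP => [dint|e]; first by rewrite floorN // subrr.
rewrite intrEfloor eq_le floor_le /=.
have -> : Num.floor d = - Num.floor (- d) by lia.
by rewrite intrN lerNr floor_le.
Qed.

Lemma same_floors_int phi m p q x : same_floors phi m -> m p -> m q ->
  (ext p.1 x - ext q.1 x \is a Num.int) =
  (ext p.2 (phi x) - ext q.2 (phi x) \is a Num.int).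
Proof.
by move=> e mp mq; rewrite !int_floorN !opprB (e _ _ mp mq) (e _ _ mq mp).
Qed.

Lemma same_floors_cr phi psi m p q : homeo01 phi psi -> same_floors phi m ->
  m p -> m q -> cr p.2 q.2 = phi @` cr p.1 q.1.
Proof.
move=> h e mp mq; have K : cancel psi phi by case: h => -[].
apply/seteqP; split=> [x /crP[x01 xi]|_ [x /crP[x01 xi] <-]].
  exists (psi x) => //; apply/crP; split.
    by rewrite (homeo01_itv _ _ _ (homeo01_sym _ _ h)).
  by rewrite (same_floors_int _ _ _ _ _ e mp mq) K.
apply/crP; rewrite (homeo01_itv _ _ _ h); split=> //.
by rewrite -(same_floors_int _ _ _ _ _ e mp mq).
Qed.

Lemma local_extremum_ext (f g : C) (t : unitI R) :
  local_extremum (f \- g) t <->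
  (\forall x \near (set_val t : R), ext f x - ext g x <= ext f (set_val t) - ext g (set_val t)) \/
  (\forall x \near (set_val t : R), ext f (set_val t) - ext g (set_val t) <= ext f x - ext g x).
Proof.
rewrite /local_extremum !near_clampI /=; rewrite !ext_val.
by split=> -[h|h]; [left|right|left|right]; apply: h.
Qed.

Lemma same_floors_le phi m p q x (k : int) : same_floors phi m -> m p -> m q ->
  (ext p.1 x - ext q.1 x <= k%:~R) = (ext p.2 (phi x) - ext q.2 (phi x) <= k%:~R).
Proof.
move=> e mp mq; have h (a b : R) : (a - b <= k%:~R) = (- k <= Num.floor (b - a)).
  by rewrite floor_ge_int intrN lerNl opprB.
by rewrite !h (e _ _ mq mp).
Qed.

Lemma same_floors_ge phi m p q x (k : int) : same_floors phi m -> m p -> m q ->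
  (k%:~R <= ext p.1 x - ext q.1 x) = (k%:~R <= ext p.2 (phi x) - ext q.2 (phi x)).
Proof. by move=> e mp mq; rewrite -!floor_ge_int (e _ _ mp mq). Qed.

Lemma equivalent_set2 m p q p' q' : equivalent m -> m p -> m q -> m p' -> m q' ->
  [set p.1; q.1] = [set p'.1; q'.1] -> [set p.2; q.2] = [set p'.2; q'.2].
Proof.
move=> e mp mq mp' mq' s.
have inj r r' : m r -> m r' -> r.1 = r'.1 -> r.2 = r'.2.
  by move=> mr mr' /(equivalent_inj _ _ _ e mr mr').
have : [set p'.1; q'.1] p.1 by rewrite -s; left.
have : [set p'.1; q'.1] q.1 by rewrite -s; right.
have : [set p.1; q.1] p'.1 by rewrite s; left.
have : [set p.1; q.1] q'.1 by rewrite s; right.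
move=> /= H1 H2 H3 H4; apply/seteqP; split=> f /= [->|->].
- by case: H4 => /inj ->; auto.
- by case: H3 => /inj ->; auto.
- by case: H2 => /inj ->; auto.
- by case: H1 => /inj ->; auto.
Qed.

(** Crossing sets are carried over by [phi]. At a crossing the difference is an integer [k], so
    being a local extremum is a comparison with [k] nearby, and comparisons with integers are
    determined by the floors. *)
Lemma transverse_equivalent m : equivalent m ->
  transverse [set p.1 | p in m] -> transverse [set p.2 | p in m].
Proof.
move=> e [disj reg]; have [phi [psi [h fl]]] := e.
have [[K K' mono] e0 e1] := h.
have inj r r' : m r -> m r' -> r.1 = r'.1 -> r.2 = r'.2.
  by move=> mr mr' /(equivalent_inj _ _ _ e mr mr').
split.
  move=> _ _ _ _ [p mp <-] [q mq <-] [p' mp' <-] [q' mq' <-] pq pq' s.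
  rewrite (same_floors_cr _ _ _ _ _ h fl mp mq).
  rewrite (same_floors_cr _ _ _ _ _ h fl mp' mq').
  apply/seteqP; split=> // x [[y cy <-] [z cz]] /(can_inj K) zy.
  have : (cr p.1 q.1 `&` cr p'.1 q'.1) y by split=> //; rewrite -zy.
  rewrite disj //; [by exists p|by exists q|by exists p'|by exists q'| | |].
  - by move/(inj _ _ mp mq).
  - by move/(inj _ _ mp' mq').
  - by move/(equivalent_set2 _ _ _ _ _ e mp mq mp' mq').
move=> _ _ [p mp <-] [q mq <-] pq.
have [||pq1|fin n0 n1 ext1] := reg p.1 q.1; [by exists p|by exists q| |].
  by apply: pq; exact: inj pq1.
rewrite (same_floors_cr _ _ _ _ _ h fl mp mq); split.
- exact: finite_image.
- by move=> [y cy]; rewrite -e0 => /(can_inj K) y0; rewrite y0 in cy.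
- by move=> [y cy]; rewrite -e1 => /(can_inj K) y1; rewrite y1 in cy.
move=> t [y cy yt]; have [y01 yint] := (crP _ _ _ _).1 cy.
have vy : set_val (clampI R y) = y by rewrite val_clampI ramp01_id.
have cphi : continuous phi by case: h => i _ _; exact: order_iso_continuous i.
move: (yint) => /intrP[k hk].
have hk2 : ext p.2 (phi y) - ext q.2 (phi y) = k%:~R.
  apply/eqP; rewrite eq_le -(same_floors_le _ _ _ _ _ _ fl mp mq).
  by rewrite -(same_floors_ge _ _ _ _ _ _ fl mp mq) hk lexx.
move=> /local_extremum_ext; rewrite -yt hk2 => lext.
apply: (ext1 (clampI R y)); first by rewrite vy.
apply/local_extremum_ext; rewrite vy hk.
case: lext => lext; [left|right].
- have nl : nbhs y (phi @^-1` [set z | ext p.2 z - ext q.2 z <= k%:~R]).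
    exact: cphi y _ lext.
  by apply: filterS nl => x /=; rewrite (same_floors_le _ _ _ _ _ _ fl mp mq).
- have nl : nbhs y (phi @^-1` [set z | k%:~R <= ext p.2 z - ext q.2 z]).
    exact: cphi y _ lext.
  by apply: filterS nl => x /=; rewrite (same_floors_ge _ _ _ _ _ _ fl mp mq).
Qed.

End TypeEquivalence.

(** * Extension of types *)

Section Finiteness.

Lemma near_finite (I : choiceType) (T : Type) (F : set_system T) (D : set I)
    (P : I -> T -> Prop) : Filter F -> finite_set D ->
  (forall i, D i -> \forall x \near F, P i x) ->
  \forall x \near F, forall i, D i -> P i x.
Proof.
move=> FF /finite_fsetP[A ->] h.
have := @filter_bigI _ _ A P F FF (fun i iA => h i iA).
by apply: filterS => x hx i iA; apply: hx.
Qed.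

Context (R : realType).

Lemma itv_avoid (lo hi : R) (s : seq R) : lo < hi ->
  exists z, lo < z < hi /\ z \notin s.
Proof.
elim: s lo hi => [|a s IH] lo hi lh.
  by exists ((lo + hi) / 2); split=> //; apply/andP; split; lra.
have [/andP[la ah]|na] := boolP (lo < a < hi).
  have [z [/andP[lz za] zs]] := IH lo a la.
  exists z; split; first by rewrite lz (lt_trans za ah).
  by rewrite inE negb_or zs lt_eqF.
have [z [zi zs]] := IH lo hi lh; exists z; split=> //.
by rewrite inE negb_or zs andbT; apply/eqP => za; rewrite -za zi in na.
Qed.

Lemma gap_around (s : seq R) (lo hi x : R) : lo < x < hi -> x \notin s ->
  exists a b, [/\ a \in lo :: s, b \in hi :: s, a < x < b &
                  forall z, z \in s -> ~~ (a < z < b)].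
Proof.
elim: s => [|c s IH] lxh.
  by exists lo, hi; rewrite !mem_head; split.
rewrite inE negb_or => /andP[xc xs].
have [a [b [ain bin /andP[ax xb] nz]]] := IH lxh xs.
have sub (d e : R) : d \in e :: s -> d \in [:: e, c & s].
  by rewrite !inE => /orP[->//|->]; rewrite !orbT.
have [ca|ac] := leP c a.
  exists a, b; split; [exact: sub|exact: sub|by rewrite ax|].
  by move=> z; rewrite inE => /orP[/eqP ->|/nz//]; rewrite ltNge ca.
have [bc|cb] := leP b c.
  exists a, b; split; [exact: sub|exact: sub|by rewrite ax|].
  by move=> z; rewrite inE => /orP[/eqP ->|/nz//]; rewrite (ltNge c) bc andbF.
have [cx|xc'] := ltP c x.
  exists c, b; split; [by rewrite !inE eqxx orbT|exact: sub|by rewrite cx|].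
  move=> z; rewrite inE => /orP[/eqP ->|/nz]; first by rewrite ltxx.
  by apply: contra => /andP[cz ->]; rewrite (lt_trans ac cz).
have xltc : x < c by rewrite lt_neqAle xc.
exists a, c; split; [exact: sub|by rewrite !inE eqxx orbT|by rewrite ax|].
move=> z; rewrite inE => /orP[/eqP ->|/nz]; first by rewrite ltxx andbF.
by apply: contra => /andP[-> zc]; rewrite (lt_trans zc cb).
Qed.

Lemma floor_convex (c d t : R) (k : int) : Num.floor c = k -> Num.floor d = k ->
  0 <= t -> t <= 1 -> Num.floor ((1 - t) * c + t * d) = k.
Proof.
move=> /eqP; rewrite floor_eq intrD => /andP[c1 c2].
move=> /eqP; rewrite floor_eq intrD => /andP[d1 d2] t0 t1.
apply/eqP; rewrite floor_eq intrD; apply/andP; split; first by nra.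
have [->|tn0] := eqVneq t 0; first by lra.
have tpos : 0 < t by rewrite lt_neqAle eq_sym tn0.
by nra.
Qed.

Lemma floor_open (c : R) (k : int) : k%:~R < c < (k + 1)%:~R ->
  Num.floor c = k /\ Num.floor (- c) = - k - 1.
Proof.
rewrite intrD => /andP[h1 h2]; split; apply/eqP; rewrite floor_eq !intrD.
  by rewrite ltW.
by rewrite !intrN; apply/andP; split; lra.
Qed.

Lemma floor_strict (c : R) : c \isn't a Num.int ->
  (Num.floor c)%:~R < c < (Num.floor c + 1)%:~R.
Proof.
move=> ni; have /andP[h1 ->] := floor_itv c; rewrite andbT lt_neqAle h1 andbT.
by apply: contra ni; rewrite intrEfloor.
Qed.

End Finiteness.

(** * Extension by a continuous function *)

Section Extension.
Context (R : realType).
Local Notation C := (C01 R).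
Implicit Types (m : set (C * C)).

(** Continuity keeps both values in the same open interval between consecutive integers. Since the
    interval is open, the floors of the opposites agree as well. *)
Lemma near_floor_open (h k : R -> R) (x0 : R) (n : int) :
  {for x0, continuous h} -> {for x0, continuous k} ->
  n%:~R < h x0 < (n + 1)%:~R -> n%:~R < k x0 < (n + 1)%:~R ->
  \forall x \near x0, Num.floor (h x) = Num.floor (k x) /\
                      Num.floor (- h x) = Num.floor (- k x).
Proof.
move=> ch ck hi ki.
have nh : nbhs x0 (h @^-1` [set z | z \in `]n%:~R, (n + 1)%:~R[]).
  by apply: ch; apply: near_in_itvoo; rewrite in_itv.
have nk : nbhs x0 (k @^-1` [set z | z \in `]n%:~R, (n + 1)%:~R[]).
  by apply: ck; apply: near_in_itvoo; rewrite in_itv.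
apply: filterS2 nh nk => x /=; rewrite !in_itv /= => /floor_open[-> ->].
by move=> /floor_open[-> ->].
Qed.

(** Crossings of [u] with two different functions belong to two different pairs, whose crossing sets
    are disjoint. *)
Lemma transverse_cross_unique (F : set C) (u f g : C) x : transverse F ->
  F u -> F f -> F g -> u <> f -> u <> g -> cr u f x -> cr u g x -> f = g.
Proof.
move=> [disj _] Fu Ff Fg uf ug xf xg; apply: contrapT => fg.
have : (cr u f `&` cr u g) x by [].
rewrite disj // => e.
have : [set u; g] f by rewrite -e; right.
by case=> [/esym|].
Qed.

(* The values allowed at [x] form an interval, which is open unless [u] crosses
   some [p.1] at [x]; in that case [p.2 \o phi + (u - p.1)] is allowed near [x]. *)
Lemma extend_function m (phi psi : R -> R) (u : C) (s : seq R) :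
  finite_set m -> homeo01 R phi psi -> same_floors R phi m ->
  transverse ([set p.1 | p in m] `|` [set u]) -> ~ [set p.1 | p in m] u ->
  exists f : C, same_floors R phi (m `|` [set (u, f)]) /\ ext f 0 \notin s.
Proof.
move=> finm h fl tr nu.
have cphi : continuous phi by case: (h) => i _ _; exact: order_iso_continuous i.
pose a (p : C * C) x := ext p.1 x; pose b (p : C * C) x := ext p.2 (phi x).
pose y x := ext u x.
have ca p : continuous (a p) by exact: ext_continuous.
have cy : continuous y by exact: ext_continuous.
have cb p : continuous (b p).
  move=> x; apply: (@continuous_comp _ _ _ phi (ext p.2)); first exact: cphi.
  exact: ext_continuous.
(* [Sp p x z] says that [z] is admissible at [phi x] as far as [p] is concerned; subtracting in both
   orders also records integrality. *)
pose Sp p x z := Num.floor (z - b p x) = Num.floor (y x - a p x) /\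
  Num.floor (b p x - z) = Num.floor (a p x - y x).
pose S x z := forall p, m p -> Sp p x z.
have Fm p : m p -> ([set p.1 | p in m] `|` [set u]) p.1 by move=> mp; left; exists p.
have Fu : ([set p.1 | p in m] `|` [set u]) u by right.
have um p : m p -> u <> p.1 by move=> mp e; apply: nu; exists p.
have openS x0 : (forall p, m p -> y x0 - a p x0 \isn't a Num.int) ->
    exists lo hi, lo < hi /\ forall z, lo < z < hi -> \forall x \near x0, S x z.
  move=> nint; have /finite_seqP[l el] := finm.
  pose k p := Num.floor (y x0 - a p x0).
  pose s1 := [seq b p x0 + (k p)%:~R | p <- l].
  pose s2 := [seq b p x0 + (k p + 1)%:~R | p <- l].
  (* Where [u] crosses nothing, [p] asks that [z] lie strictly between [b p x0 + k p] and
     [b p x0 + k p + 1]. The lower bound of [p] is below the upper bound of [q]: at [x0],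
     [a p - a q < k q + 1 - k p], and this integer bound passes to [b]. *)
  have [|lo [hi [lh h1 h2]]] := @separate_lists R s1 s2.
    move=> _ _ /mapP[p pl ->] /mapP[q ql ->].
    have mp : m p by rewrite el.
    have mq : m q by rewrite el.
    have /andP[p1 p2] := floor_itv (y x0 - a p x0).
    have /andP[q1 q2] := floor_itv (y x0 - a q x0).
    have : Num.floor (a p x0 - a q x0) < k q + 1 - k p.
      by rewrite floor_lt_int intrB /k; lra.
    rewrite (fl _ _ mp mq) floor_lt_int intrB -/(b p x0) -/(b q x0); lra.
  exists lo, hi; split=> // z /andP[loz zhi].
  apply: (@near_finite _ _ (nbhs x0) m (fun p x => Sp p x z)) => // p mp.
  have pl : p \in l by rewrite el in mp.
  have := @near_floor_open (fun x => z - b p x) (fun x => y x - a p x) x0 (k p).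
  have z1 : (k p)%:~R < z - b p x0 < (k p + 1)%:~R.
    have := h1 _ (map_f _ pl); have := h2 _ (map_f _ pl).
    by move=> ? ?; apply/andP; split; lra.
  move=> /(_ _ _ z1 (floor_strict _ _ (nint _ mp)))[||]//.
  - by apply: cvgB; [exact: cvg_cst|exact: cb].
  - by apply: cvgB; [exact: cy|exact: ca].
  move=> d d0 H; exists d => // x /H[]; rewrite !opprB; split=> //.
(* No crossing lies at 0, so a whole interval of values is available there, which leaves room to
   avoid [s]. *)
have n0 p : m p -> y 0 - a p 0 \isn't a Num.int.
  move=> mp; apply/negP => i; have [_ reg] := tr.
  have [_ c0 _ _] := reg u p.1 Fu (Fm p mp) (um p mp).
  by apply: c0; apply/crP; rewrite lexx ler01.
have [lo [hi [lh hS]]] := openS 0 n0.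
have [z0 [z0i z0s]] := itv_avoid R lo hi s lh.
have [| | |g [cg g0 gS]] := @convex_selection R S z0.
- move=> x z z' t Sz Sz' t0 t1 p mp.
  have [e1 e2] := Sz p mp; have [e1' e2'] := Sz' p mp; rewrite /Sp.
  have -> : (1 - t) * z + t * z' - b p x = (1 - t) * (z - b p x) + t * (z' - b p x).
    by ring.
  have -> : b p x - ((1 - t) * z + t * z') = (1 - t) * (b p x - z) + t * (b p x - z').
    by ring.
  by split; apply: floor_convex.
- exact: hS.
- move=> x0 x01.
  have [[p0 [mp0 i0]]|ncr] :=
      pselect (exists p, m p /\ y x0 - a p x0 \is a Num.int); last first.
    have [|lo' [hi' [lh' hS']]] := openS x0.
      by move=> p mp; apply/negP => i; apply: ncr; exists p.
    exists (cst ((lo' + hi') / 2)); split; first by move=> x; exact: cvg_cst.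
    by apply: hS'; apply/andP; split; lra.
  exists (fun x => b p0 x + (y x - a p0 x)); split.
    by move=> x; apply: cvgD; [exact: cb|apply: cvgB; [exact: cy|exact: ca]].
  apply: (@near_finite _ _ (nbhs x0) m
    (fun p x => Sp p x (b p0 x + (y x - a p0 x)))) => // p mp.
  have [pp0|pp0] := pselect (p.1 = p0.1).
    have e2 : p.2 = p0.2.
      apply/(equivalent_inj R m) => //; exists phi, psi; split=> //.
    apply: nearW => x; rewrite /Sp /a /b e2 pp0.
    by split; congr Num.floor; lra.
  have nip : y x0 - a p x0 \isn't a Num.int.
    apply/negP => ip; apply: pp0.
    by apply: (transverse_cross_unique _ u p.1 p0.1 x0 tr) => //;
      [exact: Fm|exact: Fm|exact: um|exact: um|apply/crP|apply/crP].
  pose k := Num.floor (y x0 - a p x0).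
  have := @near_floor_open (fun x => b p0 x + (y x - a p0 x) - b p x)
             (fun x => y x - a p x) x0 k.
  have /andP[k1 k2] := floor_strict _ _ nip.
  (* Let [n] be the integer [y x0 - a p0 x0]. The candidate minus [b p x0] is
     [n + (b p0 x0 - b p x0)], and the bracket is a noninteger with floor [k - n], because this
     holds for [a p0 x0 - a p x0]. *)
  have z1 : k%:~R < b p0 x0 + (y x0 - a p0 x0) - b p x0 < (k + 1)%:~R.
    move: (i0) => /intrP[n en].
    have nd : a p0 x0 - a p x0 \isn't a Num.int.
      apply: contra nip => id.
      have -> : y x0 - a p x0 = (y x0 - a p0 x0) + (a p0 x0 - a p x0) by ring.
      by rewrite rpredD.
    have fd : Num.floor (a p0 x0 - a p x0) = k - n.
      apply/eqP; rewrite floor_eq !intrD intrN -en /k; rewrite intrD in k2.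
      by apply/andP; split; lra.
    rewrite (same_floors_int _ _ _ _ _ _ fl mp0 mp) in nd.
    rewrite (fl _ _ mp0 mp) in fd.
    have := floor_strict _ _ nd; rewrite fd !intrD intrN -/(b p0 x0) -/(b p x0) en.
    by move=> /andP[? ?]; apply/andP; split; lra.
  move=> /(_ _ _ z1 (floor_strict _ _ nip))[||]//.
  - apply: cvgB; last exact: cb.
    by apply: cvgD; [exact: cb|apply: cvgB; [exact: cy|exact: ca]].
  - by apply: cvgB; [exact: cy|exact: ca].
  move=> d d0 H; exists d => // x /H[]; rewrite !opprB; split=> //.
have cpsi : continuous psi.
  by case: (homeo01_sym _ _ _ h) => i _ _; exact: order_iso_continuous i.
have [|f ef] := C01_of_continuous R (g \o psi).
  by move=> x; apply: (@continuous_comp _ _ _ psi g); [exact: cpsi|exact: cg].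
have [[K K' _] _ _] := h; have [_ psi0 _] := homeo01_sym _ _ _ h.
exists f; split; last by rewrite ef ?lexx ?ler01 //= psi0 g0.
apply: (same_floors_unit _ _ _ _ h) => p q mp mq x x01.
have efx : ext f (phi x) = g x.
  by rewrite ef /= ?K //; rewrite (homeo01_itv _ _ _ _ h).
case: mp mq => [mp|->] [mq|->] /=; first exact: fl.
- by rewrite efx; have [_ ->] := gS x x01 p mp.
- by rewrite efx; have [-> _] := gS x x01 q mq.
- by rewrite !subrr.
Qed.

End Extension.

(** * Small perturbations *)

Section Perturbation.
Context (R : realType).
Local Notation C := (C01 R).
Implicit Types (m : set (C * C)) (e : R).

(** The graph of the increasing correspondence between two finite sets, cut down to pairs at
    distance at most [e]. As a relation it can be used without fixing the enumerations hidden in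
    [sim_eps]. *)
Definition matched e (A B : set R) (r : R * R) : Prop :=
  exists s t : seq R,
    [/\ sorted <%R s, A = [set` s], sorted <%R t & B = [set` t]] /\
    size s = size t /\
    exists i, [/\ (i < size s)%N, r = (s`_i, t`_i) & `|r.1 - r.2| <= e].

Lemma matched_mem e A B r : matched e A B r -> [/\ A r.1, B r.2 & `|r.1 - r.2| <= e].
Proof.
move=> [s [t [[_ -> _ ->] [st [i [si er d]]]]]]; rewrite er in d *; split=> //=.
- by rewrite mem_nth.
- by rewrite mem_nth // -st.
Qed.

Lemma matched_inj e A B r r' : matched e A B r -> matched e A B r' ->
  r.1 = r'.1 -> r.2 = r'.2.
Proof.
have uniq_enum (s s' : seq R) : sorted <%R s -> sorted <%R s' ->
    [set` s] = [set` s'] -> s = s'.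
  move=> h h' /seteqP[h1 h2]; apply: lt_sorted_eq => // x.
  by apply/idP/idP => [/h1|/h2].
move=> [s [t [[ss -> st ->] [est [i [si -> _]]]]]].
move=> [s' [t' [[ss' /(uniq_enum _ _ ss ss') es st' /(uniq_enum _ _ st st') et]]]].
rewrite -es -et => -[_ [j [sj -> _]]] /= /eqP.
rewrite nth_uniq //; last exact: lt_sorted_uniq.
by move=> /eqP ->.
Qed.

Lemma sim_eps_matched_l e A B x : sim_eps e A B -> A x -> exists y, matched e A B (x, y).
Proof.
move=> [s [t [[ss -> st ->] [est h]]]] /= xs; exists t`_(index x s), s, t.
split=> //; split=> //; exists (index x s); rewrite index_mem; split=> //=.
  by rewrite nth_index.
by rewrite -{1}(nth_index 0 xs) h // index_mem.
Qed.

Lemma sim_eps_matched_r e A B y : sim_eps e A B -> B y -> exists x, matched e A B (x, y).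
Proof.
move=> [s [t [[ss -> st ->] [est h]]]] /= yt; exists s`_(index y t), s, t.
have it : (index y t < size s)%N by rewrite est index_mem.
split=> //; split=> //; exists (index y t); split=> //=.
  by rewrite nth_index.
by rewrite -{2}(nth_index 0 yt) h.
Qed.

Lemma sim_eps_refl e (A : set R) : 0 < e -> finite_set A -> sim_eps e A A.
Proof.
move=> e0 /finite_seqP[s0 ->]; pose s := sort <=%R (undup s0).
have es : [set` s0] = [set` s].
  by apply/seteqP; split=> x /=; rewrite mem_sort mem_undup.
exists s, s; rewrite es; split; last by split=> // i _; rewrite subrr normr0 ltW.
by split=> //; rewrite lt_sorted_uniq_le sort_uniq undup_uniq sort_le_sorted.
Qed.

Lemma cr_ramp (f g : C) x : ext f x - ext g x \is a Num.int ->
  cr f g (ramp R 0 1 x).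
Proof. by move=> h; apply/crP; rewrite ramp_ge0 ramp_le1 !ext_ramp. Qed.

Lemma ramp01_inner x : ramp R 0 1 x <> 0 -> ramp R 0 1 x <> 1 -> ramp R 0 1 x = x.
Proof.
move=> r0 r1; have [x0|x0] := leP x 0; first by rewrite ramp_eq0 in r0.
have [x1|x1] := leP 1 x; first by rewrite ramp_eq1 in r1.
by rewrite ramp01_id // !ltW.
Qed.

Lemma floor_close (c d e : R) : 0 < e -> `|c - d| < 2 * e ->
  2 * e < c - (Num.floor c)%:~R -> 2 * e < (Num.floor c + 1)%:~R - c ->
  Num.floor c = Num.floor d.
Proof.
move=> e0; rewrite ltr_norml => /andP[h1 h2] h3 h4; apply/esym/eqP.
by rewrite floor_eq; apply/andP; split; lra.
Qed.

Lemma int_close (c d : R) : c \is a Num.int -> d \is a Num.int -> `|c - d| < 1 -> c = d.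
Proof.
move=> /intrP[k ->] /intrP[l ->]; rewrite -intrB -intr_norm.
by rewrite (_ : 1 = 1%:~R) // ltr_int => h; congr (_%:~R); lia.
Qed.

(** [phi] interpolates the displacement of the crossings. At a crossing both differences are
    integers less than 1 apart; in a gap between neighbouring crossings both floors are constant and
    are compared at the midpoint. The bounds on [e] are finitely many and depend on [F] only, so [e]
    is fixed before [m]. *)
Lemma perturbation (F : set C) : finite_set F -> transverse F ->
  \forall e \near (0 : R)^'+, forall m, finite_set m ->
    (forall p, m p -> F p.1) ->
    (forall p q, m p -> m q -> p.1 = q.1 -> p.2 = q.2) ->
    (forall p, m p -> supdist p.1 p.2 < e) ->
    (forall p q, m p -> m q -> p.1 <> q.1 ->
       sim_eps e (cr p.1 q.1) (cr p.2 q.2)) ->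
    equivalent R m.
Proof.
move=> finF [disj reg].
pose D (f g : C) x := ext f x - ext g x.
pose mid (a b : R) := (a + b) / 2.
(* 0 and 1 have to be fixed by [phi]; -1 and 2 are sentinels, so that every point of the unit
   interval that is not a crossing lies inside a gap. *)
pose Z : set R := [set` [:: -1; 0; 1; 2]].
pose T : set R := Z `|`
  \bigcup_(w in F `*` F) [set x | w.1 <> w.2 /\ cr w.1 w.2 x].
have finT : finite_set T.
  rewrite finite_setU; split; first exact: finite_seq.
  apply: bigcup_finite; first exact: finite_setX.
  move=> [f g] [/= Ff Fg]; have [fg|fg] := pselect (f = g).
    by apply: sub_finite_set (finite_set0 R) => x [].
  by have [fin _ _ _] := reg f g Ff Fg fg; apply: sub_finite_set fin => x [].
have crT f g x : F f -> F g -> f <> g -> cr f g x -> T x.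
  by move=> Ff Fg fg c; right; exists (f, g).
have sep : \forall e \near (0 : R)^'+, forall a, T a -> forall b, T b ->
    a < b -> 2 * e < b - a.
  apply: near_finite => // a Ta; apply: near_finite => // b Tb.
  have [ab|_] := boolP (a < b); last by apply: nearW.
  have : \forall e \near (0 : R)^'+, e < (b - a) / 2.
    by apply: nbhs_right_lt; lra.
  by apply: filterS => e he _; lra.
have modulus : \forall e \near (0 : R)^'+, forall f, F f -> forall g, F g ->
    forall t, T t -> forall x, `|x - t| <= e -> `|D f g x - D f g t| < 1 / 2.
  apply: near_finite => // f Ff; apply: near_finite => // g Fg.
  apply: near_finite => // t Tt.
  have /cvgrPdist_lt/(_ (1/2)) := extB_continuous R f g t.
  have -> : 0 < 1 / 2 :> R by lra.
  move=> /(_ isT) /nbhs_ballP[d /= d0 hd].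
  have : \forall e \near (0 : R)^'+, e < d by apply: nbhs_right_lt.
  apply: filterS => e ed x xt; rewrite distrC; apply: hd.
  by rewrite /ball /= distrC (le_lt_trans xt ed).
(* The midpoints of all pairs in [T] are tested, since which pairs bound a gap depends on the
   difference considered. The margin [2 * e] absorbs the change of both functions. *)
have away : \forall e \near (0 : R)^'+, forall f, F f -> forall g, F g ->
    forall a, T a -> forall b, T b -> D f g (mid a b) \isn't a Num.int ->
    2 * e < D f g (mid a b) - (Num.floor (D f g (mid a b)))%:~R /\
    2 * e < (Num.floor (D f g (mid a b)) + 1)%:~R - D f g (mid a b).
  apply: near_finite => // f Ff; apply: near_finite => // g Fg.
  apply: near_finite => // a Ta; apply: near_finite => // b Tb.
  set c := mid a b.
  have [i|ni] := pselect (D f g c \is a Num.int).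
    by apply: nearW => e /negP.
  move/negP in ni.
  have /andP[h1 h2] := floor_strict _ _ ni.
  have n1 : \forall e \near (0 : R)^'+, e < (D f g c - (Num.floor (D f g c))%:~R) / 2.
    by apply: nbhs_right_lt; lra.
  have n2 : \forall e \near (0 : R)^'+, e < ((Num.floor (D f g c) + 1)%:~R - D f g c) / 2.
    by apply: nbhs_right_lt; lra.
  by apply: filterS2 n1 n2 => e e1 e2 _; split; lra.
have small : \forall e \near (0 : R)^'+, e < 1 / 4 by apply: nbhs_right_lt; lra.
have pos : \forall e \near (0 : R)^'+, 0 < e by apply: nbhs_right_gt.
near=> e => m finm mF inj close sim.
have e_sep : forall a, T a -> forall b, T b -> a < b -> 2 * e < b - a by near: e.
have e_mod : forall f, F f -> forall g, F g ->
    forall t, T t -> forall x, `|x - t| <= e -> `|D f g x - D f g t| < 1 / 2 by near: e.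
have e_away : forall f, F f -> forall g, F g ->
    forall a, T a -> forall b, T b -> D f g (mid a b) \isn't a Num.int ->
    2 * e < D f g (mid a b) - (Num.floor (D f g (mid a b)))%:~R /\
    2 * e < (Num.floor (D f g (mid a b)) + 1)%:~R - D f g (mid a b) by near: e.
have e_small : e < 1 / 4 by near: e.
have e_pos : 0 < e by near: e.
pose M (p q : C * C) := matched e (cr p.1 q.1) (cr p.2 q.2).
pose P : set (R * R) := [set (z, z) | z in Z] `|`
  \bigcup_(w in m `*` m) [set r | w.1.1 <> w.2.1 /\ M w.1 w.2 r].
have PM p q r : m p -> m q -> p.1 <> q.1 -> M p q r -> P r.
  by move=> mp mq pq h; right; exists (p, q).
have crin p q x : m p -> m q -> p.1 <> q.1 -> cr p.1 q.1 x -> 0 < x < 1.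
  move=> mp mq pq c; have [_ c0 c1 _] := reg _ _ (mF _ mp) (mF _ mq) pq.
  have [/andP[x0 x1] _] := (crP _ _ _ _).1 c.
  rewrite !lt_neqAle x0 x1 !andbT; apply/andP; split; apply/eqP => ex.
    by apply: c0; rewrite ex.
  by apply: c1; rewrite -ex.
have PT r : P r -> T r.1 /\ `|r.1 - r.2| <= e.
  case=> [[z Zz <-]|[[p q] [/= mp mq] [pq /matched_mem[h1 _ h2]]]] /=.
    by split; [left|rewrite subrr normr0 ltW].
  by split=> //; apply: crT pq h1; apply: mF.
have finP : finite_set P.
  rewrite finite_setU; split; first by apply: finite_image; exact: finite_seq.
  apply: bigcup_finite; first exact: finite_setX.
  move=> [p q] [/= mp mq]; have [pq|pq] := pselect (p.1 = q.1).
    by apply: sub_finite_set (finite_set0 _) => x [].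
  have [s [t [[_ es _ et] _]]] := sim p q mp mq pq.
  apply: (@sub_finite_set _ _ (cr p.1 q.1 `*` cr p.2 q.2)).
    by move=> r [_ /matched_mem[]].
  by rewrite es et; apply: finite_setX; exact: finite_seq.
have [||phi [psi [iso phiP]]] := order_iso_through R P finP.
- move=> r r' Pr Pr' lt; have [Tr d] := PT r Pr; have [Tr' d'] := PT r' Pr'.
  have := e_sep _ Tr _ Tr' lt.
  by move: d d'; rewrite !ler_norml => /andP[? ?] /andP[? ?] ?; lra.
- have ZP z p q r : Z z -> m p -> m q -> p.1 <> q.1 -> M p q r -> r.1 <> z.
    move=> Zz mp mq pq /matched_mem[/(crin _ _ _ mp mq pq) /andP[h1 h2] _ _] rz.
    by move: Zz; rewrite -rz /Z /= !inE => /or4P[] /eqP; lra.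
  move=> r r' [[z Zz <-]|[[p q] [/= mp mq] [pq Mr]]].
    case=> [[z' _ <-]//|[[p q] [/= mp mq] [pq Mr]]] /= ez.
    by case: (ZP _ _ _ _ Zz mp mq pq Mr).
  case=> [[z Zz <-]|[[p' q'] [/= mp' mq'] [pq' Mr']]] /= er.
    by case: (ZP _ _ _ _ Zz mp mq pq Mr).
  (* By disjointness of crossing sets, both crossings come from the same unordered pair of
     functions, and exchanging the two functions does not affect [M]. *)
  have [Ar _ _] := matched_mem _ _ _ _ Mr; have [Ar' _ _] := matched_mem _ _ _ _ Mr'.
  have se : [set p.1; q.1] = [set p'.1; q'.1].
    apply: contrapT => ns; have : (cr p.1 q.1 `&` cr p'.1 q'.1) r.1.
      by split=> //; rewrite er.
    by rewrite disj //; apply: mF.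
  suff eM : M p q = M p' q'.
    by apply: (matched_inj _ _ _ _ _ Mr _ er); move: Mr'; rewrite -eM.
  have : [set p'.1; q'.1] p.1 by rewrite -se; left.
  have : [set p'.1; q'.1] q.1 by rewrite -se; right.
  rewrite /M => -[] e1 [] e2; have e1' := inj _ _ mq _ e1; have e2' := inj _ _ mp _ e2.
  - by case: pq; rewrite e1 e2.
  - by rewrite e1 e2 e1' // e2' // (crC _ q'.1) (crC _ q'.2).
  - by rewrite e1 e2 e1' // e2'.
  - by case: pq; rewrite e1 e2.
have ZP z : Z z -> phi z = z.
  by move=> Zz; apply: (phiP (z, z)); left; exists z.
have h01 : homeo01 R phi psi.
  by split=> //; apply: ZP; rewrite /Z /= !inE eqxx ?orbT.
have [K K' mono] := iso; have lmono := order_iso_lt _ _ _ iso.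
exists phi, psi; split=> //; apply: (same_floors_unit _ _ _ _ h01) => p q mp mq x x01.
have [pq|pq] := pselect (p.1 = q.1); first by rewrite pq (inj _ _ mp mq pq) !subrr.
have Fp := mF _ mp; have Fq := mF _ mq.
rewrite -/(D p.1 q.1 x) -/(D p.2 q.2 (phi x)).
have Dclose z : `|D p.1 q.1 z - D p.2 q.2 z| < 2 * e.
  have /supdist_ltP/(_ z) := close _ mp; have /supdist_ltP/(_ z) := close _ mq.
  rewrite /D !ltr_norml => /andP[? ?] /andP[? ?]; apply/andP; split; lra.
have [cx|ncx] := pselect (cr p.1 q.1 x).
  have [x' Mx] := sim_eps_matched_l _ _ _ _ (sim _ _ mp mq pq) cx.
  have ex : phi x = x' by apply: (phiP (x, x')); exact: PM Mx.
  have [_ cx' xx'] := matched_mem _ _ _ _ Mx.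
  have [_ i1] := (crP _ _ _ _).1 cx; have [_ i2] := (crP _ _ _ _).1 cx'.
  congr Num.floor; rewrite ex; apply: int_close => //.
  have Tx : T x by exact: crT cx.
  have := e_mod _ Fp _ Fq x Tx x'; rewrite distrC => /(_ xx').
  have := Dclose x'; rewrite !ltr_norml => /andP[? ?] /andP[? ?].
  by apply/andP; split; lra.
have [s [t [[_ es _ _] _]]] := sim _ _ mp mq pq.
have [||a [b [ain bin axb nab]]] := gap_around R s (-1) 2 x.
- by case/andP: x01 => ? ?; apply/andP; split; lra.
- by apply/negP => xs; apply: ncx; rewrite es.
have abP z : z \in -1 :: s \/ z \in 2 :: s -> T z /\ `|phi z - z| <= e.
  have Zok w : Z w -> T w /\ `|phi w - w| <= e.
    by move=> Zw; split; [left|rewrite ZP // subrr normr0 ltW].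
  have sok w : w \in s -> T w /\ `|phi w - w| <= e.
    move=> ws; have cw : cr p.1 q.1 w by rewrite es.
    have [w' Mw] := sim_eps_matched_l _ _ _ _ (sim _ _ mp mq pq) cw.
    have -> : phi w = w' by apply: (phiP (w, w')); exact: PM Mw.
    have [_ _ h] := matched_mem _ _ _ _ Mw; rewrite distrC; split=> //.
    exact: crT cw.
  by case; rewrite inE => /orP[/eqP ->|/sok//]; apply: Zok; rewrite /Z /= !inE eqxx ?orbT.
have [Ta da] := abP a (or_introl ain); have [Tb db] := abP b (or_intror bin).
have [ax xb] := andP axb; have ab := lt_trans ax xb.
have := e_sep _ Ta _ Tb ab => sab.
pose c := mid a b.
have acb : a < c < b by apply/andP; split; rewrite /c /mid; lra.
(* Each end moves by at most [e] and [2 * e < b - a], so the midpoint [c] also lies in the image of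
   the gap and serves for both differences. *)
have pacb : phi a < c < phi b.
  move: da db; rewrite !ler_norml => /andP[? ?] /andP[? ?].
  by apply/andP; split; rewrite /c /mid; lra.
have n1 z : a < z < b -> D p.1 q.1 z \isn't a Num.int.
  move=> zab; apply/negP => i; have cz := cr_ramp _ _ _ i.
  have /andP[z0 z1] := crin _ _ _ mp mq pq cz.
  have ez : ramp R 0 1 z = z.
    by apply: ramp01_inner => ez; move: z0 z1; rewrite ez ltxx.
  have : z \in s by rewrite ez es in cz.
  by move/nab; rewrite zab.
(* Every crossing on the second side is the image of one on the first, so the image of a gap
   contains no crossing. *)
have n2 z : phi a < z < phi b -> D p.2 q.2 z \isn't a Num.int.
  move=> zab; apply/negP => i; have cz := cr_ramp _ _ _ i.
  have [y My] := sim_eps_matched_r _ _ _ _ (sim _ _ mp mq pq) cz.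
  have ey : phi y = ramp R 0 1 z by apply: (phiP (y, _)); exact: PM My.
  have [cy _ _] := matched_mem _ _ _ _ My.
  have /andP[y0 y1] := crin _ _ _ mp mq pq cy.
  have [_ phi0 phi1] := h01.
  have ez : ramp R 0 1 z = z.
    apply: ramp01_inner; rewrite -ey => ez.
      by move: y0; rewrite -lmono phi0 ez ltxx.
    by move: y1; rewrite -lmono phi1 ez ltxx.
  have : y \in s by rewrite es in cy.
  by move/nab; rewrite -(lmono a) -(lmono y) ey ez zab.
rewrite (floor_constant_gap R _ _ _ x c (extB_continuous R p.1 q.1) n1 axb acb).
have pxab : phi a < phi x < phi b by rewrite !lmono.
rewrite (floor_constant_gap R _ _ _ (phi x) c (extB_continuous R p.2 q.2) n2 pxab pacb).
have [c1 c2] := e_away _ Fp _ Fq _ Ta _ Tb (n1 _ acb).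
exact: floor_close e_pos (Dclose c) c1 c2.
Unshelve. all: by end_near.
Qed.

End Perturbation.

(** * Extension within a smoothly dense set *)

Section ApproximateExtension.
Context (R : realType).
Local Notation C := (C01 R).

(** The type is first extended by a continuous [f]; then [f] is replaced by a smooth approximation
    [v] in [V], with the functions of [F] kept. The forbidden set [S] is avoided through values at
    0. *)
Lemma equivalent_extend (V : set C) (m : set (C * C)) (u : C) (S : set C) :
  smoothly_dense V -> finite_set m -> finite_set S ->
  (forall p, m p -> V p.2) -> equivalent R m ->
  transverse ([set p.1 | p in m] `|` [set u]) -> ~ [set p.1 | p in m] u ->
  exists v, [/\ V v, ~ S v & equivalent R (m `|` [set (u, v)])].
Proof.
move=> [_ _ _ sd] finm finS mV [phi [psi [h fl]]] tr nu.
have /finite_seqP[s es] := finite_image (fun f : C => ext f 0) finS.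
have [f [ffl fs]] := extend_function R m phi psi u s finm h fl tr nu.
have eqf : equivalent R (m `|` [set (u, f)]) by exists phi, psi.
pose F := [set p.2 | p in m].
have finF : finite_set F by exact: finite_image.
have FV : F `<=` V by move=> _ [p mp <-]; exact: mV.
have nF : ~ F f.
  move=> [p mp pf]; apply: nu; exists p => //.
  by apply/(equivalent_inj R _ p (u, f) eqf) => //; [left|right].
have img1 : [set p.1 | p in m `|` [set (u, f)]] = [set p.1 | p in m] `|` [set u].
  by rewrite image_setU image_set1.
have img2 : [set p.2 | p in m `|` [set (u, f)]] = F `|` [set f].
  by rewrite image_setU image_set1.
have trF : transverse (F `|` [set f]).
  by rewrite -img2; apply: transverse_equivalent eqf _; rewrite img1.
have finFf : finite_set (F `|` [set f]) by rewrite finite_setU; split.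
have pert := perturbation R _ finFf trF.
(* [f] differs at 0 from every member of [S], and [e] is below these differences, so no member of
   [S] is within [e] of [f]. *)
have sepS : \forall e \near (0 : R)^'+, forall w, S w -> e < `|ext f 0 - ext w 0|.
  apply: near_finite => // w Sw; apply: nbhs_right_lt.
  rewrite normr_gt0 subr_eq0; apply: contra fs => /eqP ->.
  suff : [set` s] (ext w 0) by [].
  by rewrite -es; exists w.
have pos : \forall e \near (0 : R)^'+, 0 < e by apply: nbhs_right_gt.
have [e [[hp hs] e0]] := filter_ex (filterI (filterI pert sepS) pos).
have [v Vv [dv simv]] := sd F f e finF FV nF trF e0.
exists v; split=> //.
  move=> Sv; have := hs v Sv; have /supdist_ltP/(_ 0) := dv; lra.
pose m' : set (C * C) := [set (g, g) | g in F] `|` [set (f, v)].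
have eqm' : equivalent R m'.
  apply: hp.
  - by rewrite finite_setU; split=> //; exact: finite_image.
  - by move=> p [[g Fg <-]|->]; [left|right].
  - move=> p q [[g Fg <-]|->] [[g' Fg' <-]|->] //= e1; case: nF.
      by rewrite -e1.
    by rewrite e1.
  - move=> p [[g Fg <-]|->] //=.
    by apply/supdist_ltP => x; rewrite subrr normr0.
  - have [_ reg] := trF.
    move=> p q [[g Fg <-]|->] [[g' Fg' <-]|->] //= ne.
    + have [fin _ _ _] := reg g g' (or_introl Fg) (or_introl Fg') ne.
      exact: sim_eps_refl.
    + by rewrite (crC _ g f) (crC _ g v); exact: simv.
    + exact: simv.
apply: equivalent_comp eqf eqm' _ => -[a b] [mab|[-> ->]].
  by exists b; split; [left|left; exists b => //; exists (a, b)].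
by exists f; split; right.
Qed.

End ApproximateExtension.

(** * Independent events *)

Section Independence.
Context (R : realType) (d : measure_display) (T : measurableType d)
  (P : probability T R) (I : choiceType) (D : set I) (E : I -> set T) (p : R).
Context (mE : forall i, D i -> measurable (E i))
  (pE : forall i, D i -> P (E i) = p%:E) (indE : mutually_independent P D E).

Definition pr (X : set T) : R := fine (P X).

Lemma prE X : measurable X -> P X = (pr X)%:E.
Proof. by move=> mX; rewrite /pr fineK // fin_num_measure. Qed.

Lemma pr_ge0 X : 0 <= pr X.
Proof. exact: fine_ge0. Qed.

Lemma pr_setT : pr setT = 1.
Proof. by rewrite /pr probability_setT. Qed.

Lemma pr_setIC X Y : measurable X -> measurable Y ->
  pr (X `&` ~` Y) = pr X - pr (X `&` Y).
Proof.
move=> mX mY.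
have : P X = (P (X `&` ~` Y) + P (X `&` Y))%E by rewrite -setDE; exact: measureDI.
have mXY : measurable (X `&` ~` Y) by apply: measurableI => //; exact: measurableC.
by rewrite !prE //; [move=> [->]; rewrite addrK|exact: measurableI].
Qed.

Definition allE (J : {fset I}) : set T := \bigcap_(i in [set` J]) E i.

Lemma measurable_allE (J : {fset I}) : [set` J] `<=` D -> measurable (allE J).
Proof.
move=> JD; apply: fin_bigcap_measurable => [|i iJ]; last exact/mE/JD.
exact: finite_fset.
Qed.

Lemma pr_allE (J : {fset I}) : [set` J] `<=` D -> pr (allE J) = p ^+ #|` J|.
Proof.
move=> JD; rewrite /pr /allE indE //.
rewrite (eq_big_seq (fun=> p%:E)); last by move=> i iJ; apply/pE/JD.
by rewrite prodEFin /= big_const_seq count_predT iter_mulr_1.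
Qed.

(* The hypothesis only gives the product rule for intersections of the [E i];
   recording the set [S] of indices already used allows complements, and then
   complements of whole patterns, to be adjoined one after the other. *)
Definition indep_off (S : set I) (X : set T) : Prop :=
  measurable X /\ forall J : {fset I}, [set` J] `<=` D `\` S ->
    pr (X `&` allE J) = pr X * p ^+ #|` J|.

Lemma indep_off_setT : indep_off set0 setT.
Proof.
split=> // J; rewrite setD0 => JD.
by rewrite setTI pr_allE // pr_setT mul1r.
Qed.

Lemma indep_off_setI S X i : indep_off S X -> D i -> ~ S i ->
  indep_off (S `|` [set i]) (X `&` E i) /\ pr (X `&` E i) = pr X * p.
Proof.
move=> [mX iX] Di nSi.
have prXi : pr (X `&` E i) = pr X * p.
  have := iX [fset i]%fset; rewrite /allE set_fset1 bigcap_set1 cardfs1 expr1; apply.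
  by move=> _ ->.
split=> //; split; first by apply: measurableI => //; exact: mE.
move=> J JD; have iJ : i \notin J.
  by apply/negP => iJ; have [_] := JD i iJ; apply; right.
have JDS : [set` (i |` J)%fset] `<=` D `\` S.
  move=> j /= /fset1UP[->//|/JD[Dj nj]]; split=> // Sj.
  by apply: nj; left.
have := iX _ JDS; rewrite /allE bigcap_fsetU1 setIA => ->.
by rewrite prXi cardfsU1 iJ add1n exprS mulrA.
Qed.

(** The complement is handled by subtraction: both [X] and its intersection with [B] obey the
    product rule against [allE J]. The larger set [S'] accounts for the indices used by [B]. *)
Lemma indep_offD S S' X B c : S `<=` S' -> indep_off S X -> measurable B ->
  indep_off S' (X `&` B) -> pr (X `&` B) = pr X * c ->
  indep_off S' (X `&` ~` B) /\ pr (X `&` ~` B) = pr X * (1 - c).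
Proof.
move=> SS' [mX iX] mB [_ iXB] prc.
have prB : pr (X `&` ~` B) = pr X * (1 - c) by rewrite pr_setIC // prc; ring.
split=> //; split; first by apply: measurableI => //; exact: measurableC.
move=> J JD; have JD' : [set` J] `<=` D by move=> j /JD[].
have JDS : [set` J] `<=` D `\` S by move=> j /JD[Dj nj]; split=> // /SS'.
rewrite setIAC pr_setIC //; last by apply: measurableI => //; exact: measurable_allE.
by rewrite iX // setIAC iXB // prB prc; ring.
Qed.

Fixpoint pattern (es : seq (I * bool)) : set T :=
  if es is (i, b) :: es' then (if b then E i else ~` E i) `&` pattern es'
  else setT.

(** It depends only on the Booleans, so the same requirements over different indices have the same
    probability. *)
Definition pattern_weight (bs : seq bool) : R :=
  \prod_(b <- bs) (if b then p else 1 - p).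

Lemma patternP es w : pattern es w <-> forall i b, (i, b) \in es -> E i w <-> b.
Proof.
elim: es => [|[i b] es IH] /=; first by split.
split=> [[Ei /IH Ees] j c|H].
  rewrite inE => /orP[/eqP[-> ->]|jc]; last exact: Ees.
  by case: b Ei => // nE; split.
split; last by apply: IH.2 => j c jc; apply: H; rewrite inE jc orbT.
have := H i b (mem_head _ _); case: b {H} => -[h1 h2]; first exact: h2.
by move=> /h1.
Qed.

Lemma indep_off_pattern S X (es : seq (I * bool)) : indep_off S X ->
  uniq (unzip1 es) -> (forall i, i \in unzip1 es -> D i /\ ~ S i) ->
  [/\ measurable (pattern es),
      indep_off (S `|` [set` unzip1 es]) (X `&` pattern es) &
      pr (X `&` pattern es) = pr X * pattern_weight (unzip2 es)].
Proof.
elim: es S X => [|[i b] es IH] S X iX /=.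
  move=> _ _; rewrite setIT /pattern_weight big_nil mulr1; split=> //.
  by rewrite (_ : [set` [::]] = set0) ?setU0 //; apply/seteqP; split.
move=> /andP[ies ues] HD.
have [Di nSi] := HD i (mem_head _ _).
have [iXE prXE] := indep_off_setI _ _ _ iX Di nSi.
have sub : S `<=` S `|` [set i] by left.
have [iXN prXN] := indep_offD _ _ _ _ _ sub iX (mE _ Di) iXE prXE.
pose Eb := if b then E i else ~` E i.
have mEb : measurable Eb by rewrite /Eb; case: (b); [|apply: measurableC]; exact: mE.
have [iXb prXb] : indep_off (S `|` [set i]) (X `&` Eb) /\
    pr (X `&` Eb) = pr X * (if b then p else 1 - p).
  by rewrite /Eb; case: (b).
have [j jes|mp ip prp] := IH _ _ iXb ues.
  have jin : j \in i :: unzip1 es by rewrite inE jes orbT.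
  have [Dj nj] := HD j jin; split=> // -[//|ji].
  by rewrite -ji jes in ies.
rewrite setIA; split; first exact: measurableI.
- rewrite (_ : S `|` [set` i :: unzip1 es] = S `|` [set i] `|` [set` unzip1 es]) //.
  rewrite -setUA; congr (_ `|` _); apply/seteqP; split=> j /=; rewrite inE.
    by move=> /orP[/eqP|]; [left|right].
  by case=> [->|->]; rewrite ?eqxx ?orbT.
- by rewrite prp prXb /pattern_weight big_cons mulrA.
Qed.

(** Since the flattened list has no repetition, the patterns use disjoint sets of indices; their
    complements are adjoined one at a time, each contributing a factor [1 - pattern_weight bs]. *)
Lemma pr_no_pattern (ess : seq (seq (I * bool))) (bs : seq bool) :
  (forall es, es \in ess -> unzip2 es = bs) ->
  uniq (flatten [seq unzip1 es | es <- ess]) ->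
  (forall i, i \in flatten [seq unzip1 es | es <- ess] -> D i) ->
  exists2 X, indep_off [set` flatten [seq unzip1 es | es <- ess]] X &
    pr X = (1 - pattern_weight bs) ^+ size ess /\
    forall w, (forall es, es \in ess -> ~ pattern es w) -> X w.
Proof.
elim: ess => [|es ess IH] /=.
  move=> _ _ _; exists setT; last by rewrite pr_setT.
  rewrite (_ : [set` [::]] = set0); first exact: indep_off_setT.
  by apply/seteqP; split.
move=> bsE; rewrite cat_uniq => /and3P[ues dis uess] HD.
have [| |i iess|X iX [prX HX]] := IH.
- by move=> es' es'in; apply: bsE; rewrite inE es'in orbT.
- by [].
- by apply: HD; rewrite mem_cat iess orbT.
have [i ies|mp ip prp] := indep_off_pattern _ _ es iX ues.
  split; first by apply: HD; rewrite mem_cat ies.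
  by move=> iess; move/negP: dis; apply; apply/hasP; exists i.
rewrite bsE ?mem_head // in prp.
have [|iXN prXN] := indep_offD _ _ _ _ _ _ iX mp ip prp; first by left.
exists (X `&` ~` pattern es).
  rewrite (_ : [set` _] = [set` flatten [seq unzip1 es | es <- ess]] `|` [set` unzip1 es]) //.
  apply/seteqP; split=> i /=; rewrite mem_cat.
    by move=> /orP[]; [right|left].
  by case=> ->; rewrite ?orbT.
split; first by rewrite prXN prX exprSr.
move=> w H; split; last by apply: H; rewrite mem_head.
by apply: HX => es' es'in; apply: H; rewrite inE es'in orbT.
Qed.

(** The covers intersect in a measurable set whose probability is at most [r ^+ n] for every [n],
    hence 0. *)
Lemma negligible_small (B : set T) (r : R) : 0 <= r < 1 ->
  (forall n, exists X, [/\ measurable X, B `<=` X & pr X <= r ^+ n]) ->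
  P.-negligible B.
Proof.
move=> /andP[r0 r1] /choice[X HX].
exists (\bigcap_n X n); split.
- by apply: bigcap_measurable => // n _; have [] := HX n.
- have mX : measurable (\bigcap_n X n).
    by apply: bigcap_measurable => // n _; have [] := HX n.
  rewrite prE //; congr EFin; apply/eqP; rewrite eq_le pr_ge0 andbT.
  have cv : (fun n => r ^+ n) @ \oo --> (0 : R) by apply: cvg_expr; rewrite ger0_norm.
  rewrite -(cvg_lim _ cv) //; apply: limr_ge; first by apply/cvg_ex; exists 0.
  apply: nearW => n; have [mXn _] := HX n; apply: le_trans.
  have : (P (\bigcap_n X n) <= P (X n))%E.
    by apply: le_measure; rewrite ?inE //; exact: bigcap_inf.
  by rewrite !prE // lee_fin.
- by move=> w Bw n _; have [_ + _] := HX n; apply.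
Qed.

Lemma negligible_bigcup_inj (X : Type) (c : X -> nat) (B : X -> set T) :
  injective c -> (forall x, P.-negligible (B x)) ->
  P.-negligible (\bigcup_x B x).
Proof.
move=> cinj nB.
apply: (@negligibleS _ _ _ _ (\bigcup_n \bigcup_(x in [set x | c x = n]) B x)).
  by move=> w [x _ Bx]; exists (c x) => //; exists x.
apply: negligible_bigcup => n; have [[x cx]|nx] := pselect (exists x, c x = n).
  apply: negligibleS (nB x) => w [y /= cy By].
  by rewrite (cinj x y) // cx.
apply: negligibleS (negligible_set0 P) => w [y cy _].
by apply: nx; exists y.
Qed.

End Independence.

(** * Back-and-forth *)

Section BackAndForth.
Context (A B : Type) (cA : A -> nat) (cB : B -> nat).

(** Stage [k] treats the elements of code [k] on both sides, if they exist, and the union of the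
    stages is the graph of [f]. Any two pairs lie in a common stage, which is what transfers a
    binary relation such as adjacency. *)
Lemma back_and_forth (good : set (set (A * B))) :
  injective cA -> injective cB -> good set0 ->
  (forall m, good m -> forall a, exists b, good (m `|` [set (a, b)])) ->
  (forall m, good m -> forall b, exists a, good (m `|` [set (a, b)])) ->
  (forall m, good m -> forall p q, m p -> m q -> p.1 = q.1 <-> p.2 = q.2) ->
  exists2 f : A -> B, bijective f &
    forall a a', exists2 m, good m & m (a, f a) /\ m (a', f a').
Proof.
move=> cAinj cBinj good0 forth back inj.
have step (km : nat * {m | good m}) : exists m' : {m | good m},
    [/\ sval km.2 `<=` sval m',
        forall a, cA a = km.1 -> exists b, sval m' (a, b) &
        forall b, cB b = km.1 -> exists a, sval m' (a, b)].
  case: km => k [m gm] /=.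
  have [m1 [gm1 mm1 H1]] : exists m1, [/\ good m1, m `<=` m1 &
      forall a, cA a = k -> exists b, m1 (a, b)].
    have [[a ca]|na] := pselect (exists a, cA a = k); last first.
      by exists m; split=> // a ca; case: na; exists a.
    have [b gb] := forth m gm a; exists (m `|` [set (a, b)]); split=> //.
    by move=> a'; rewrite -ca => /cAinj ->; exists b; right.
  have [m2 [gm2 mm2 H2]] : exists m2, [/\ good m2, m1 `<=` m2 &
      forall b, cB b = k -> exists a, m2 (a, b)].
    have [[b cb]|nb] := pselect (exists b, cB b = k); last first.
      by exists m1; split=> // b cb; case: nb; exists b.
    have [a ga] := back m1 gm1 b; exists (m1 `|` [set (a, b)]); split=> //.
    by move=> b'; rewrite -cb => /cBinj ->; exists a; right.
  exists (exist _ m2 gm2); split=> //=; first exact: subset_trans mm2.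
  by move=> a /H1[b /mm2]; exists b.
have [next Hnext] := choice step.
pose M := fix M k := if k is k'.+1 then next (k', M k') else exist good set0 good0.
have Mle k l : (k <= l)%N -> sval (M k) `<=` sval (M l).
  elim: l => [|l IH]; first by rewrite leqn0 => /eqP ->.
  rewrite leq_eqVlt => /orP[/eqP -> //|/IH kl].
  by apply: subset_trans kl _; have [] := Hnext (l, M l).
have Minj k l p q : sval (M k) p -> sval (M l) q -> p.1 = q.1 <-> p.2 = q.2.
  move=> /(Mle _ _ (leq_maxl k l)) Mp /(Mle _ _ (leq_maxr k l)) Mq.
  by apply: inj Mp Mq; exact: svalP.
have /choice[f Hf] : forall a, exists b, exists k, sval (M k) (a, b).
  move=> a; have [_ /(_ a erefl)[b Mb] _] := Hnext (cA a, M (cA a)).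
  by exists b, (cA a).+1.
have /choice[g Hg] : forall b, exists a, exists k, sval (M k) (a, b).
  move=> b; have [_ _ /(_ b erefl)[a Ma]] := Hnext (cB b, M (cB b)).
  by exists a, (cB b).+1.
exists f.
  exists g => [a|b].
    have [k Mk] := Hf a; have [l Ml] := Hg (f a).
    by apply/(Minj _ _ _ _ Ml Mk).
  have [k Mk] := Hf (g b); have [l Ml] := Hg b.
  by apply/(Minj _ _ _ _ Mk Ml).
move=> a a'; have [k Mk] := Hf a; have [l Ml] := Hf a'.
exists (sval (M (maxn k l))); first exact: svalP.
by split; [apply: Mle Mk; exact: leq_maxl|apply: Mle Ml; exact: leq_maxr].
Qed.

End BackAndForth.

(** * Rich graphs *)

Lemma set2_eq (T : Type) (u v x y : T) : [set u; v] = [set x; y] ->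
  u = x /\ v = y \/ u = y /\ v = x.
Proof.
move=> e.
have hu : [set x; y] u by rewrite -e; left.
have hv : [set x; y] v by rewrite -e; right.
have hx : [set u; v] x by rewrite e; left.
have hy : [set u; v] y by rewrite e; right.
case: hu => [ux|uy]; case: hv => [vx|vy].
- by left; split=> //; case: hy => ->; rewrite // ux vx.
- by left.
- by right.
- by right; split=> //; case: hx => ->; rewrite // uy vy.
Qed.

Lemma adjC (T : Type) (G : sgraph T) x y : adj G x y <-> adj G y x.
Proof. by rewrite /adj setUC. Qed.

Lemma adj_irrefl (T : Type) (G : sgraph T) x : ~ adj G x x.
Proof.
move=> e; have [a [b [ab eab]]] := @edges_pair _ _ _ e.
by case: (set2_eq _ _ _ _ _ eab) => -[xa xb]; apply: ab; rewrite -xa -xb.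
Qed.

Section RichGraphs.
Context (R : realType).
Local Notation C := (C01 R).
Implicit Types (V : set C).

Lemma transverse_sub (F F' : set C) : F `<=` F' -> transverse F' -> transverse F.
Proof.
move=> FF' [disj reg]; split=> [f g f' g' Ff Fg Ff' Fg'|f g Ff Fg].
  by apply: disj; apply: FF'.
by apply: reg; apply: FF'.
Qed.

Lemma set_valV V (v : set_type V) : V (set_val v).
Proof. by apply: set_mem; exact: valP. Qed.

Lemma set_val_inj V : injective (set_val : set_type V -> C).
Proof. exact: val_inj. Qed.

Lemma near_pairs_set2 V (u v : set_type V) : near_pairs V [set u; v] ->
  supdist (set_val u) (set_val v) < 1.
Proof.
move=> [x [y [_ d e]]]; case: (set2_eq _ _ _ _ _ e) => -[-> ->] //.
by apply/supdist_ltP => z; rewrite distrC; move: z; apply/supdist_ltP.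
Qed.

(** [F] matched with itself: equivalence after adding the pair of [v] and [w] says that these have
    the same type over [F]. *)
Definition diag V (F : set (set_type V)) : set (C * C) :=
  [set (set_val h, set_val h) | h in F].

(* Quantifying over the vertex [v] rather than over its type keeps the number of
   requirements countable. *)
Definition rich V (G : sgraph (set_type V)) : Prop :=
  edges G `<=` near_pairs V /\
  forall (F N : set (set_type V)) (v : set_type V), finite_set F -> ~ F v ->
    (forall h, N h -> F h /\ supdist (set_val v) (set_val h) < 1) ->
    exists w : set_type V,
      [/\ ~ F w, equivalent R (diag V F `|` [set (set_val v, set_val w)]) &
          forall h, F h -> adj G w h <-> N h].

Lemma same_type_many V (F : set (set_type V)) (v : set_type V) (n : nat) :
  smoothly_dense V -> finite_set F -> ~ F v ->
  exists ws : seq (set_type V), [/\ uniq ws, size ws = n &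
    forall w, w \in ws -> ~ F w /\
      equivalent R (diag V F `|` [set (set_val v, set_val w)])].
Proof.
move=> sd finF nF; have [_ trV _ _] := sd.
have img1 : [set p.1 | p in diag V F] = set_val @` F.
  by rewrite /diag image_comp.
elim: n => [|n [ws [uws sws Hws]]]; first by exists [::].
have [| | | | | | |x [Vx nx ex]] := @equivalent_extend R V (diag V F) (set_val v)
    (set_val @` (F `|` [set` ws])).
- exact: sd.
- exact: finite_image.
- by apply: finite_image; rewrite finite_setU; split=> //; exact: finite_seq.
- by move=> _ [h _ <-]; exact: set_valV.
- apply: equivalent_sub (equivalent_diag R setT) => _ [h _ <-]; by split.
- apply: transverse_sub trV; rewrite img1.
  by move=> _ [[h _ <-]|->]; exact: set_valV.
- by rewrite img1 => -[h Fh /set_val_inj hv]; apply: nF; rewrite -hv.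
pose w : set_type V := exist _ x (mem_set Vx).
have wx : set_val w = x by [].
have nw : ~ (F `|` [set` ws]) w by move=> h; apply: nx; exists w.
exists (w :: ws); split=> /=; last first.
- move=> w'; rewrite inE => /orP[/eqP ->|/Hws//]; split; last by rewrite wx.
  by move=> Fw; apply: nw; left.
- by rewrite sws.
- by rewrite uws andbT; apply/negP => ww; apply: nw; right.
Qed.

(** * Almost sure richness of the random graph *)

Section Random.
Context (V : set C) (p : R) (d : measure_display) (T : measurableType d)
  (P : probability T R) (G : T -> sgraph (set_type V)).
Context (sdV : smoothly_dense V) (p01 : 0 < p < 1) (larg : is_LARG V p P G).

(** For [n] vertices with the type of [v], the sets of possible edges to [F] are disjoint, so all of
    them miss the pattern [N] with probability [(1 - c) ^+ n], where [c] is positive and independent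
    of [n]. *)
Lemma realised_ae (F N : set (set_type V)) (v : set_type V) :
  finite_set F -> ~ F v ->
  (forall h, N h -> F h /\ supdist (set_val v) (set_val h) < 1) ->
  P.-negligible [set om | ~ exists w : set_type V,
      [/\ ~ F w, equivalent R (diag V F `|` [set (set_val v, set_val w)]) &
          forall h, F h -> adj (G om) w h <-> N h]].
Proof.
move=> finF nF HN; have [sub mE pE ind] := larg.
(* Vertices of [F] at distance at least 1 from [v] are as far from every [w] of the same type and
   never adjacent to it, so the pattern concerns [near_v] only. *)
pose near_v := [set h | F h /\ supdist (set_val v) (set_val h) < 1].
have /finite_seqP[l0 el0] : finite_set near_v.
  by apply: sub_finite_set finF => h [].
pose l := undup l0.
have lP h : h \in l <-> near_v h by rewrite el0 /= mem_undup.
pose bs := [seq `[< N h >] | h <- l].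
pose es (w : set_type V) := [seq ([set w; h], `[< N h >]) | h <- l].
have es1 w : unzip1 (es w) = [seq [set w; h] | h <- l].
  by rewrite /unzip1 /es -map_comp.
have es2 w : unzip2 (es w) = bs by rewrite /unzip2 /es -map_comp.
pose c := pattern_weight R p bs.
have c01 : 0 < c <= 1.
  rewrite /c /pattern_weight; case/andP: p01 => p0 p1.
  elim: (bs) => [|b s /andP[IH1 IH2]]; first by rewrite big_nil ltr01 lexx.
  rewrite big_cons; apply/andP; split; first by rewrite mulr_gt0 //; case: b; lra.
  by apply: mulr_ile1 => //; case: b; lra.
have nearw (w h : set_type V) : equivalent R (diag V F `|` [set (set_val v, set_val w)]) -> F h ->
    supdist (set_val v) (set_val h) < 1 <-> supdist (set_val w) (set_val h) < 1.
  move=> ew Fh; apply: (equivalent_near R _ (set_val v, set_val w)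
    (set_val h, set_val h) ew); first by right.
  by left; exists h.
apply: (@negligible_small _ _ _ P _ (1 - c)).
  by case/andP: c01 => c0 c1; apply/andP; split; lra.
move=> n; have [ws [uws sws Hws]] := same_type_many V F v n sdV finF nF.
have flatE : flatten [seq unzip1 e | e <- [seq es w | w <- ws]] =
    [seq [set w; h] | w <- ws, h <- l].
  by rewrite -map_comp; congr flatten; apply: eq_map => w /=; rewrite es1.
have [|||X [mX _] [prX HX]] := @pr_no_pattern _ _ _ P _ _ _ p mE pE ind
    [seq es w | w <- ws] bs.
- by move=> _ /mapP[w _ ->]; exact: es2.
- rewrite flatE; apply: allpairs_uniq => //; first exact: undup_uniq.
  move=> _ _ /allpairsP[[w h] [/= wws hl ->]] /allpairsP[[w' h'] [/= wws' hl' ->]].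
  move=> /= e; case: (set2_eq _ _ _ _ _ e) => -[wh hw]; first by rewrite wh hw.
  have [nFw _] := Hws _ wws; have [Fh' _] := (lP h').1 hl'.
  by case: nFw; rewrite wh.
- move=> i; rewrite flatE => /allpairsP[[w h] [/= wws hl ->]].
  have [nFw ew] := Hws _ wws; have [Fh dh] := (lP h).1 hl.
  exists w, h; split=> //; first by move=> wh; apply: nFw; rewrite wh.
  exact: ((nearw _ _ ew Fh).1 dh).
exists X; split=> //; last by rewrite prX size_map sws.
move=> om nom; apply: HX => _ /mapP[w wws ->] pat; apply: nom.
have [nFw ew] := Hws _ wws; exists w; split=> // h Fh.
have [dh|ndh] := pselect (supdist (set_val v) (set_val h) < 1).
  have hl : h \in l by apply/lP.
  have := (patternP _ _ _ _ (es w) om).1 pat [set w; h] `[< N h >].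
  by move=> /(_ (map_f _ hl)) H; split=> [/H /asboolP|/asboolP /H].
split=> [/sub /near_pairs_set2 dwh|/HN[]//].
by case: ndh; exact: ((nearw _ _ ew Fh).2 dwh).
Qed.

(** With finite sets given by lists, the requirements are indexed by triples that have an injective
    code in [nat], and a countable union of null events is null. *)
Lemma LARG_rich : countable V -> {ae P, forall om, rich V (G om)}.
Proof.
move=> /countable_injP[f finj].
pose cV (v : set_type V) := f (set_val v).
have cVinj : injective cV.
  by move=> u v /finj e; apply: set_val_inj; apply: e; rewrite inE; exact: set_valV.
(* The conditions on the triple are put inside the event, so that triples violating them give an
   empty event. *)
pose bad (x : seq (set_type V) * seq (set_type V) * set_type V) : set T :=
  [set om | ~ (~ [set` x.1.1] x.2 ->
    (forall h, [set` x.1.2] h ->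
       [set` x.1.1] h /\ supdist (set_val x.2) (set_val h) < 1) ->
    exists w : set_type V, [/\ ~ [set` x.1.1] w,
      equivalent R (diag V [set` x.1.1] `|` [set (set_val x.2, set_val w)]) &
      forall h, [set` x.1.1] h -> adj (G om) w h <-> [set` x.1.2] h])].
pose code (x : seq (set_type V) * seq (set_type V) * set_type V) :=
  choice.pickle (map cV x.1.1, map cV x.1.2, cV x.2).
have code_inj : injective code.
  move=> [[s t] v] [[s' t'] v'] /(pcan_inj choice.pickleK)[].
  by move=> /(inj_map cVinj) -> /(inj_map cVinj) -> /cVinj ->.
have nbad : P.-negligible (\bigcup_x bad x).
  apply: (negligible_bigcup_inj _ _ _ _ _ code) => // -[[s t] v].
  have [nF|nF] := pselect (~ [set` s] v); last first.
    by apply: negligibleS (negligible_set0 P) => om; apply.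
  have [HN|HN] := pselect (forall h, [set` t] h ->
       [set` s] h /\ supdist (set_val v) (set_val h) < 1); last first.
    by apply: negligibleS (negligible_set0 P) => om; apply.
  apply: negligibleS (realised_ae [set` s] [set` t] v _ nF HN).
    by move=> om /= nb ex; apply: nb.
  exact: finite_seq.
apply: negligibleS nbad => om /= nrich; apply: contrapT => nb; apply: nrich.
have [sub _ _ _] := larg; split; first exact: sub.
move=> F N v finF nF HN.
have finN : finite_set N by apply: sub_finite_set finF => h /HN[].
move: finF finN nF HN => /finite_seqP[s ->] /finite_seqP[t ->] nF HN.
apply: contrapT => nex; apply: nb; exists (s, t, v) => // H.
by apply: nex; exact: H.
Qed.

End Random.

(** * Isomorphism of rich graphs *)

Definition partial_iso V V' (G : sgraph (set_type V)) (G' : sgraph (set_type V'))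
    (m : set (set_type V * set_type V')) : Prop :=
  [/\ finite_set m, equivalent R [set (set_val p.1, set_val p.2) | p in m] &
      forall p q, m p -> m q -> adj G p.1 q.1 <-> adj G' p.2 q.2].

Lemma partial_iso_inj V V' (G : sgraph (set_type V)) (G' : sgraph (set_type V'))
    m p q : partial_iso V V' G G' m -> m p -> m q -> p.1 = q.1 <-> p.2 = q.2.
Proof.
move=> [_ e _] mp mq.
have := equivalent_inj R _ (set_val p.1, set_val p.2) (set_val q.1, set_val q.2) e.
move=> /(_ (ex_intro2 _ _ p mp erefl) (ex_intro2 _ _ q mq erefl)) /= H.
split=> h; apply: set_val_inj; first by apply: H.1; rewrite h.
by apply: H.2; rewrite h.
Qed.

Lemma partial_iso_sym V V' (G : sgraph (set_type V)) (G' : sgraph (set_type V')) m :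
  partial_iso V V' G G' m -> partial_iso V' V G' G [set p | m (p.2, p.1)].
Proof.
move=> [finm e a]; split.
- apply: sub_finite_set (finite_image (fun p => (p.2, p.1)) finm) => p /= mp.
  by exists (p.2, p.1) => //=; rewrite -surjective_pairing.
- apply: equivalent_sub (equivalent_sym R _ e) => _ [p mp <-] /=.
  by exists (p.2, p.1).
- by move=> p q /= mp mq; have := a _ _ mp mq => /= H; split=> /H.
Qed.

(** First [equivalent_extend] gives [v] in [V'] whose type corresponds to that of [a]; then richness
    of [G'] replaces [v] by some [w] of the same type with the adjacencies of [a]. *)
Lemma partial_iso_forth V V' (G : sgraph (set_type V)) (G' : sgraph (set_type V')) m a :
  smoothly_dense V -> smoothly_dense V' -> rich V G -> rich V' G' ->
  partial_iso V V' G G' m -> exists b, partial_iso V V' G G' (m `|` [set (a, b)]).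
Proof.
move=> [_ trV _ _] sdV' [nearG _] [nearG' richG'] iso; have [finm em am] := iso.
have [[b mab]|na] := pselect (exists b, m (a, b)).
  exists b; rewrite (_ : _ `|` _ = m) //; apply/seteqP; split=> [p [//|->//]|p mp].
  by left.
pose mC : set (C * C) := [set (set_val p.1, set_val p.2) | p in m].
have img1 : [set p.1 | p in mC] = [set set_val p.1 | p in m].
  by rewrite /mC image_comp.
have [| | | | | | |x [Vx _ ex]] := @equivalent_extend R V' mC (set_val a) set0.
- exact: sdV'.
- exact: finite_image.
- exact: finite_set0.
- by move=> _ [p _ <-]; exact: set_valV.
- exact: em.
- apply: transverse_sub trV; rewrite img1.
  by move=> _ [[p _ <-]|->]; exact: set_valV.
- rewrite img1 => -[[a' b] mp /set_val_inj /= pa]; apply: na; exists b.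
  by rewrite -pa.
pose v : set_type V' := exist _ x (mem_set Vx).
have ev : equivalent R (mC `|` [set (set_val a, set_val v)]) by [].
have mCin p : m p -> (mC `|` [set (set_val a, set_val v)]) (set_val p.1, set_val p.2).
  by move=> mp; left; exists p.
have newin : (mC `|` [set (set_val a, set_val v)]) (set_val a, set_val v) by right.
pose F := [set p.2 | p in m].
pose N := [set h | exists p, [/\ m p, p.2 = h & adj G a p.1]].
have nFv : ~ F v.
  move=> [[a' b] mp /= bv]; apply: na; exists b.
  suff <- : a' = a by [].
  apply: set_val_inj; apply/(equivalent_inj R _ _ _ ev (mCin _ mp) newin).
  by rewrite /= bv.
(* Neighbours of [a] are near [a], and nearness depends only on the type, so the pattern [N] is
   admissible for [v]. *)
have HN h : N h -> F h /\ supdist (set_val v) (set_val h) < 1.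
  move=> [p [mp <- ap]]; split; first by exists p.
  apply/(equivalent_near R _ _ _ ev newin (mCin _ mp)) => /=.
  exact/near_pairs_set2/nearG.
have finF : finite_set F by exact: finite_image.
have [w [nFw ew aw]] := richG' F N v finF nFv HN.
exists w.
have aN p : m p -> adj G a p.1 <-> adj G' w p.2.
  move=> mp; rewrite aw; last by exists p.
  split=> [ap|[q [mq qp aq]]]; first by exists p.
  by rewrite -((partial_iso_inj _ _ _ _ _ _ _ iso mq mp).2 qp).
split.
- by rewrite finite_setU.
- apply: equivalent_comp ev ew _ => _ [p [mp|->] <-] /=.
    exists (set_val p.2); split; first exact: mCin.
    by left; exists p.2 => //; exists p.
  by exists (set_val v); split; right.
- move=> p q [mp|->] [mq|->] /=; first exact: am.
  + by rewrite (adjC _ G) (adjC _ G'); exact: aN.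
  + exact: aN.
  + by split=> h; case: (adj_irrefl _ _ _ h).
Qed.

Lemma rich_iso V V' (G : sgraph (set_type V)) (G' : sgraph (set_type V')) :
  countable V -> countable V' -> smoothly_dense V -> smoothly_dense V' ->
  rich V G -> rich V' G' -> graph_iso G G'.
Proof.
move=> /countable_injP[f finj] /countable_injP[f' finj'] sd sd' rG rG'.
have [| | | | | |h hbij hm] := @back_and_forth (set_type V) (set_type V')
    (f \o set_val) (f' \o set_val) (partial_iso V V' G G').
- by move=> u v /finj e; apply: set_val_inj; apply: e; rewrite inE; exact: set_valV.
- by move=> u v /finj' e; apply: set_val_inj; apply: e; rewrite inE; exact: set_valV.
- split=> //.
  by apply: equivalent_sub (equivalent_diag R set0) => r [p []].
- by move=> m gm a; exact: partial_iso_forth.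
(* The backward step is the forward step for the inverse matching. *)
- move=> m /partial_iso_sym gm b.
  have [a /partial_iso_sym ga] := partial_iso_forth _ _ _ _ _ b sd' sd rG' rG gm.
  exists a; suff -> : m `|` [set (a, b)] =
      [set p | ([set p0 | m (p0.2, p0.1)] `|` [set (b, a)]) (p.2, p.1)] by [].
  apply/seteqP; split=> -[a' b'] /= [mp|[-> ->]]; by [left|right].
- by move=> m gm p q; exact: partial_iso_inj gm.
exists h => // x y; have [m [_ _ am] [mx my]] := hm x y.
exact: am mx my.
Qed.

End RichGraphs.

Theorem theorem4 (R : realType) :
  exists (W : Type) (GR : sgraph W),
    countable [set: W] /\
    forall (V : set (C01 R)) (p : R),
      countable V -> smoothly_dense V -> 0 < p < 1 ->
      forall (d : measure_display) (T : measurableType d) (P : probability T R)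
             (G : T -> sgraph (set_type V)),
        is_LARG V p P G ->
        {ae P, forall w, graph_iso (G w) GR}.
Proof.
(* Any rich graph over a countable smoothly dense set serves, as all of these are isomorphic. If
   there is none, no outcome of a sample is rich although almost every one is, so any graph will do
   and the one-point graph is taken. *)
have [[V0 [G0 [cV0 sd0 r0]]]|none] := pselect (exists (V : set (C01 R))
    (G : sgraph (set_type V)), [/\ countable V, smoothly_dense V & rich R V G]).
  exists (set_type V0), G0; split.
    have /countable_injP[f finj] := cV0; apply/countable_injP.
    exists (f \o set_val) => u v _ _ /finj e.
    by apply: set_val_inj; apply: e; rewrite inE; exact: set_valV.
  move=> V p cV sd p01 d T P G larg.
  apply: filterS (LARG_rich R V p d T P G sd p01 larg cV) => om rG.
  exact: rich_iso.
have empty_pair (e : set unit) : set0 e -> exists x y : unit, x <> y /\ e = [set x; y].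
  by [].
exists unit, (SGraph empty_pair); split; first exact: countableP.
move=> V p cV sd p01 d T P G larg.
apply: filterS (LARG_rich R V p d T P G sd p01 larg cV) => om rG.
by case: none; exists V, (G om).
Qed.
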